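(* For any nonnegative integer $\gamma$, the operad $\mathsf{DAs}_\gamma$ is the vector space of $\gamma$-alternating Schröder trees. Moreover, for any $\gamma$-alternating Schröder trees $\mathfrak{s}$ and $\mathfrak{t}$, $\mathfrak{s} \circ_i \mathfrak{t}$ is the $\gamma$-alternating Schröder tree obtained by grafting the root of $\mathfrak{t}$ on the $i$th leaf $x$ of $\mathfrak{s}$ and then, if the father $y$ of $x$ and the root $z$ of $\mathfrak{t}$ have a same label, by contracting the edge connecting $y$ and $z$.
   Context: The ground field has characteristic zero; operad means nonsymmetric operad; $[\gamma] = \{1, \dots, \gamma\}$; $a \uparrow a' := \max(a, a')$. $\mathbf{Free}(\mathfrak{G})$ is the free operad on a set $\mathfrak{G}$ of binary generators. A Schröder tree is a planar rooted tree in which every internal node has at least two children (the tree reduced to a leaf is allowed, as the unit). A $\gamma$-alternating Schröder tree is a Schröder tree whose internal nodes are labeled by elements of $[\gamma]$ in such a way that the label of an internal node is different from the labels of its children that are internal nodes. The arity of such a tree is its number of leaves. ''The operad is the vector space of...'' means that it is isomorphic, as an operad, to the graded vector space spanned by these trees with the given partial compositions. $\mathsf{As}_\gamma$ is the operad $\mathbf{Free}(\{\star_a : a \in [\gamma]\})/\langle \mathfrak{R} \rangle$, where the $\star_a$ are binary generators and $\mathfrak{R}$ is generated by $\star_a \circ_1 \star_{a'} - \star_{a \uparrow a'} \circ_2 \star_{a \uparrow a'}$ and $\star_a \circ_2 \star_{a'} - \star_{a \uparrow a'} \circ_2 \star_{a \uparrow a'}$, $a, a' \in [\gamma]$. $\mathsf{DAs}_\gamma$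 is its Koszul dual, that is, $\mathbf{Free}(\{\star_a : a \in [\gamma]\})/\langle \mathfrak{R}^\perp \rangle$, where $\mathfrak{R}^\perp$ is the annihilator of $\mathfrak{R}$ in $\mathbf{Free}(\{\star_a\})(3)$ for the bilinear form with $\langle x \circ_i y, x' \circ_{i'} y' \rangle = 1$ if $x = x', y = y', i = i' = 1$; $= -1$ if $x = x', y = y', i = i' = 2$; and $0$ otherwise. Equivalently, $\mathsf{DAs}_\gamma$ is presented by $\gamma$ binary generators $\diamond_a$, $a \in [\gamma]$, subject only to the relations $\diamond_a \circ_1 \diamond_a = \diamond_a \circ_2 \diamond_a$, $a \in [\gamma]$. *)

(* Defs.v *)
From HB Require Import structures.
From mathcomp Require Import all_boot all_order all_algebra.
From mathcomp Require Import boolp finmap monalg zify.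

Set Implicit Arguments.
Unset Strict Implicit.
Unset Printing Implicit Defensive.

Import GRing.Theory.
Local Open Scope ring_scope.

Definition ncast (O : nat -> Type) m n (e : m = n) (x : O m) : O n :=
  ecast k (O k) e x.

(* The inputs are numbered from 0: [op_comp x i y] is usually written
   x o_(i+1) y.  The index [k] of an outer composition is only known up to an
   equation on its value, and the two sides of an associativity law live in
   components whose indices are equal but not convertible, whence [ncast];
   the equations [e] are always satisfiable under the hypotheses on i, j, k. *)
Record operad (K : fieldType) := Operad {
  op_sort :> nat -> lmodType K;
  op_unit : op_sort 1%N;
  op_comp : forall n m, op_sort n -> 'I_n -> op_sort m -> op_sort (n + m).-1;
  op_comp_linearl : forall n m (i : 'I_n) (y : op_sort m),
    linear (fun x => op_comp x i y);
  op_comp_linearr : forall n m (x : op_sort n) (i : 'I_n),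
    linear (@op_comp n m x i);
  op_unitl : forall n (x : op_sort n), op_comp op_unit ord0 x = x;
  op_unitr : forall n (x : op_sort n) (i : 'I_n) (e : (n + 1).-1 = n),
    ncast (O := op_sort) e (op_comp x i op_unit) = x;
  op_compA : forall n m l (x : op_sort n) (y : op_sort m) (z : op_sort l)
      (i : 'I_n) (j : 'I_m) (k : 'I_(n + m).-1)
      (e : ((n + m).-1 + l).-1 = (n + (m + l).-1).-1),
    k = (i + j)%N :> nat ->
    ncast (O := op_sort) e (op_comp (op_comp x i y) k z)
      = op_comp x i (op_comp y j z);
  op_compC : forall n m l (x : op_sort n) (y : op_sort m) (z : op_sort l)
      (i j : 'I_n) (k : 'I_(n + m).-1) (i' : 'I_(n + l).-1)
      (e : ((n + m).-1 + l).-1 = ((n + l).-1 + m).-1),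
    (i < j)%N -> k = (j + m).-1 :> nat -> i' = i :> nat ->
    ncast (O := op_sort) e (op_comp (op_comp x i y) k z)
      = op_comp (op_comp x j z) i' y
}.

Arguments op_unit {K} o.
Arguments op_comp {K o n m} x i y.

Definition operad_isomorphism (K : fieldType) (P Q : operad K)
    (phi : forall n, {linear P n -> Q n}) : Prop :=
  [/\ forall n, bijective (phi n),
      phi 1%N (op_unit P) = op_unit Q
    & forall n m (x : P n) (i : 'I_n) (y : P m),
        phi _ (op_comp x i y) = op_comp (phi n x) i (phi m y)].

Section LmodQuotient.
Variables (K : fieldType) (V : lmodType K) (S : zmodClosed V).
Local Open Scope quotient_scope.

Definition lmod_quot (_ : GRing.scaler_closed S) := Quotient.quot S.

Variable scaleS : GRing.scaler_closed S.
Local Notation Q := (lmod_quot scaleS).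

HB.instance Definition _ := GRing.Zmodule.on Q.
HB.instance Definition _ : EqQuotient V (Quotient.equiv S) Q :=
  EqQuotient.on Q.

Lemma quot_surj (x : Q) : exists v, x = \pi_Q v.
Proof. by exists (repr x); rewrite reprK. Qed.

Definition quot_scale (a : K) (x : Q) : Q := \pi_Q (a *: repr x).

Lemma pi_quotP (x y : V) : reflect (\pi_Q x = \pi_Q y) (x - y \in S).
Proof. by rewrite (Quotient.idealrBE S); apply: (@eqP (Quotient.quot S)). Qed.

Fact pi_quotD (x y : V) : \pi_Q (x + y) = \pi_Q x + \pi_Q y.
Proof. exact: (raddfD (\pi_(Quotient.quot S))). Qed.

Lemma pi_quotZ a (x : V) : \pi_Q (a *: x) = quot_scale a (\pi_Q x).
Proof. by apply/pi_quotP; rewrite -scalerBr scaleS //; apply/pi_quotP; rewrite reprK. Qed.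

Fact quot_scaleA a b x : quot_scale a (quot_scale b x) = quot_scale (a * b) x.
Proof. by have [v ->] := quot_surj x; rewrite -!pi_quotZ scalerA. Qed.

Fact quot_scale1 : left_id 1 quot_scale.
Proof. by move=> x; have [v ->] := quot_surj x; rewrite -pi_quotZ scale1r. Qed.

Fact quot_scaleDr : right_distributive quot_scale +%R.
Proof.
move=> a x y; have [v ->] := quot_surj x; have [w ->] := quot_surj y.
by rewrite -pi_quotD -!pi_quotZ scalerDr pi_quotD.
Qed.

Fact quot_scaleDl x : {morph quot_scale^~ x : a b / a + b}.
Proof. by move=> a b /=; have [v ->] := quot_surj x; rewrite -!pi_quotZ scalerDl pi_quotD. Qed.

HB.instance Definition _ := GRing.Zmodule_isLmodule.Build K Q
  quot_scaleA quot_scale1 quot_scaleDr quot_scaleDl.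

Fact pi_quot_linear : linear (\pi_Q : V -> Q).
Proof. by move=> a x y; rewrite pi_quotD pi_quotZ. Qed.

End LmodQuotient.

Record operad_ideal (K : fieldType) (O : operad K) := OperadIdeal {
  ideal_pred :> forall n, O n -> bool;
  ideal_submod : forall n, submod_closed (@ideal_pred n);
  ideal_compl : forall n m (x : O n) (i : 'I_n) (y : O m),
    ideal_pred x -> ideal_pred (op_comp x i y);
  ideal_compr : forall n m (x : O n) (i : 'I_n) (y : O m),
    ideal_pred y -> ideal_pred (op_comp x i y)
}.

Section QuotientOperad.
Variables (K : fieldType) (O : operad K) (I : operad_ideal O).
Local Open Scope quotient_scope.

Fact ideal_zmod n : zmod_closed (@ideal_pred _ _ I n).
Proof. by have Iid := ideal_submod I n; apply: (Iid : GRing.zmod_closed _). Qed.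

Fact ideal_scale n : GRing.scaler_closed (@ideal_pred _ _ I n).
Proof. by have Iid := ideal_submod I n; apply: (Iid : GRing.scaler_closed _). Qed.

HB.instance Definition _ n :=
  GRing.isZmodClosed.Build (O n) (@ideal_pred _ _ I n) (ideal_zmod n).

Definition quot_sort n : lmodType K := lmod_quot (@ideal_scale n).

Definition quot_pi n (x : O n) : quot_sort n := \pi_(lmod_quot (@ideal_scale n)) x.

Definition quot_repr n (x : quot_sort n) : O n :=
  repr (x : lmod_quot (@ideal_scale n)).

Lemma quot_reprK n (x : quot_sort n) : quot_pi (quot_repr x) = x.
Proof. exact: (@reprK _ (lmod_quot (@ideal_scale n))). Qed.

Lemma quot_pi_surj n (x : quot_sort n) : exists v, x = quot_pi v.
Proof. by exists (quot_repr x); rewrite quot_reprK. Qed.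

Lemma quot_piP n (x y : O n) : reflect (quot_pi x = quot_pi y) (I n (x - y)).
Proof. exact: pi_quotP. Qed.

Lemma quot_pi_linear n : linear (@quot_pi n).
Proof. exact: pi_quot_linear. Qed.

Definition quot_unit : quot_sort 1 := quot_pi (op_unit O).

Definition quot_comp n m (x : quot_sort n) (i : 'I_n) (y : quot_sort m) :
    quot_sort (n + m).-1 :=
  quot_pi (op_comp (quot_repr x) i (quot_repr y)).

Lemma quot_pi_comp n m (x : O n) (i : 'I_n) (y : O m) :
  quot_pi (op_comp x i y) = quot_comp (quot_pi x) i (quot_pi y).
Proof.
rewrite /quot_comp.
transitivity (quot_pi (op_comp (quot_repr (quot_pi x)) i y)).
  apply/quot_piP.
  have := @op_comp_linearl _ O n m i y (-1) (quot_repr (quot_pi x)) x.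
  rewrite !scaleN1r ![- _ + _]addrC => <-; apply: ideal_compl.
  by apply/quot_piP; rewrite quot_reprK.
apply/quot_piP.
have := @op_comp_linearr _ O n m (quot_repr (quot_pi x)) i (-1)
  (quot_repr (quot_pi y)) y.
rewrite !scaleN1r ![- _ + _]addrC => <-; apply: ideal_compr.
by apply/quot_piP; rewrite quot_reprK.
Qed.

Lemma quot_pi_cast m n (e : m = n) (x : O m) :
  quot_pi (ncast (O := op_sort O) e x) = ncast (O := quot_sort) e (quot_pi x).
Proof. by case: n / e. Qed.

Fact quot_comp_linearl n m (i : 'I_n) (y : quot_sort m) :
  linear (fun x => quot_comp x i y).
Proof.
move=> a x x'; have [x0 ->] := quot_pi_surj x; have [x'0 ->] := quot_pi_surj x'; have [y0 ->] := quot_pi_surj y.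
by rewrite -quot_pi_linear -!quot_pi_comp op_comp_linearl quot_pi_linear.
Qed.

Fact quot_comp_linearr n m (x : quot_sort n) (i : 'I_n) :
  linear (@quot_comp n m x i).
Proof.
move=> a y y'; have [x0 ->] := quot_pi_surj x; have [y0 ->] := quot_pi_surj y; have [y'0 ->] := quot_pi_surj y'.
by rewrite -quot_pi_linear -!quot_pi_comp op_comp_linearr quot_pi_linear.
Qed.

Fact quot_unitl n (x : quot_sort n) : quot_comp quot_unit ord0 x = x.
Proof. by have [x0 ->] := quot_pi_surj x; rewrite -quot_pi_comp op_unitl. Qed.

Fact quot_unitr n (x : quot_sort n) (i : 'I_n) (e : (n + 1).-1 = n) :
  ncast (O := quot_sort) e (quot_comp x i quot_unit) = x.
Proof. by have [x0 ->] := quot_pi_surj x; rewrite -quot_pi_comp -quot_pi_cast op_unitr. Qed.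

Fact quot_compA n m l (x : quot_sort n) (y : quot_sort m) (z : quot_sort l)
    (i : 'I_n) (j : 'I_m) (k : 'I_(n + m).-1)
    (e : ((n + m).-1 + l).-1 = (n + (m + l).-1).-1) :
  k = (i + j)%N :> nat ->
  ncast (O := quot_sort) e (quot_comp (quot_comp x i y) k z)
    = quot_comp x i (quot_comp y j z).
Proof.
have [x0 ->] := quot_pi_surj x; have [y0 ->] := quot_pi_surj y; have [z0 ->] := quot_pi_surj z; move=> eqk.
by rewrite -!quot_pi_comp -quot_pi_cast (op_compA _ _ _ _ eqk).
Qed.

Fact quot_compC n m l (x : quot_sort n) (y : quot_sort m) (z : quot_sort l)
    (i j : 'I_n) (k : 'I_(n + m).-1) (i' : 'I_(n + l).-1)
    (e : ((n + m).-1 + l).-1 = ((n + l).-1 + m).-1) :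
  (i < j)%N -> k = (j + m).-1 :> nat -> i' = i :> nat ->
  ncast (O := quot_sort) e (quot_comp (quot_comp x i y) k z)
    = quot_comp (quot_comp x j z) i' y.
Proof.
have [x0 ->] := quot_pi_surj x; have [y0 ->] := quot_pi_surj y; have [z0 ->] := quot_pi_surj z; move=> ltij eqk eqi.
by rewrite -!quot_pi_comp -quot_pi_cast (op_compC _ _ _ _ ltij eqk eqi).
Qed.

Definition quotient_operad : operad K :=
  Operad quot_comp_linearl quot_comp_linearr quot_unitl quot_unitr
    quot_compA quot_compC.

End QuotientOperad.

Section GeneratedIdeal.
Variables (K : fieldType) (O : operad K) (k : nat) (R : O k -> Prop).

Definition gen_ideal_pred n (x : O n) : bool :=
  `[< forall I : operad_ideal O, (forall r, R r -> I k r) -> I n x >].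

Fact gen_ideal_submod n : submod_closed (@gen_ideal_pred n).
Proof.
split=> [|a x y /asboolP Ix /asboolP Iy]; apply/asboolP => I RI.
  by have [] := ideal_submod I n.
by have [_ Ilin] := ideal_submod I n; apply: Ilin; [apply: Ix | apply: Iy].
Qed.

Fact gen_ideal_compl n m (x : O n) (i : 'I_n) (y : O m) :
  gen_ideal_pred x -> gen_ideal_pred (op_comp x i y).
Proof.
by move=> /asboolP Ix; apply/asboolP => I RI; apply/ideal_compl/Ix.
Qed.

Fact gen_ideal_compr n m (x : O n) (i : 'I_n) (y : O m) :
  gen_ideal_pred y -> gen_ideal_pred (op_comp x i y).
Proof.
by move=> /asboolP Iy; apply/asboolP => I RI; apply/ideal_compr/Iy.
Qed.

Definition gen_ideal : operad_ideal O :=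
  OperadIdeal gen_ideal_submod gen_ideal_compl gen_ideal_compr.

End GeneratedIdeal.

(* An operad in the category of sets whose components are merged into a single
   type; a composition [so_comp x i y] is meaningful when [i < so_arity x]. *)
Record set_operad := SetOperad {
  so_sort :> choiceType;
  so_arity : so_sort -> nat;
  so_unit : so_sort;
  so_comp : so_sort -> nat -> so_sort -> so_sort;
  so_arity_unit : so_arity so_unit = 1%N;
  so_arity_comp : forall x i y, (i < so_arity x)%N ->
    so_arity (so_comp x i y) = (so_arity x + so_arity y).-1;
  so_unitl : forall x, so_comp so_unit 0 x = x;
  so_unitr : forall x i, (i < so_arity x)%N -> so_comp x i so_unit = x;
  so_compA : forall x y z i j, (i < so_arity x)%N -> (j < so_arity y)%N ->
    so_comp (so_comp x i y) (i + j) z = so_comp x i (so_comp y j z);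
  so_compC : forall x y z i j, (i < j)%N -> (j < so_arity x)%N ->
    so_comp (so_comp x i y) (j + so_arity y).-1 z = so_comp (so_comp x j z) i y
}.

Arguments so_arity {s} x.
Arguments so_unit s : clear implicits.
Arguments so_comp {s} x i y.

Definition lin_span (K : fieldType) (T : choiceType) : lmodType K := {malg K[T]}.

Section LinearExtension.
Variables (K : fieldType) (V : lmodType K) (T : choiceType) (f : T -> V).

Definition lin_ext (x : lin_span K T) : V := \sum_(t <- msupp x) x@_t *: f t.

Lemma lin_extEw (x : {malg K[T]}) (D : {fset T}) : (msupp x `<=` D)%fset ->
  lin_ext x = \sum_(t <- D) x@_t *: f t.
Proof.
move=> sxD; rewrite /lin_ext (big_fset_incl _ sxD) //= => t _ /mcoeff_outdom ->.
by rewrite scale0r.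
Qed.

Lemma lin_ext_linear : linear lin_ext.
Proof.
move=> a x y; pose D := (msupp x `|` msupp y `|` msupp (a *: x + y))%fset.
have sxD : (msupp x `<=` D)%fset by rewrite /D -fsetUA fsubsetUl.
have syD : (msupp y `<=` D)%fset.
  by rewrite /D (fsetUC (msupp x)) -fsetUA fsubsetUl.
rewrite (lin_extEw sxD) (lin_extEw syD) (@lin_extEw _ D) ?fsubsetUr //.
rewrite scaler_sumr -big_split /=; apply: eq_bigr => t _.
by rewrite mcoeffD mcoeffZ scalerDl scalerA.
Qed.

Lemma lin_extU t : lin_ext << t >> = f t.
Proof.
by rewrite (lin_extEw msuppU_le) big_seq_fset1 mcoeffUU scale1r.
Qed.

Lemma lin_span_eq (g h : lin_span K T -> V) : linear g -> linear h ->
  (forall t, g << t >> = h << t >>) -> g =1 h.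
Proof.
move=> lin_g lin_h gh x.
pose gl := HB.pack_for {linear lin_span K T -> V} g
  (GRing.isLinear.Build K (lin_span K T) V *:%R g lin_g).
pose hl := HB.pack_for {linear lin_span K T -> V} h
  (GRing.isLinear.Build K (lin_span K T) V *:%R h lin_h).
have -> : x = \sum_(t <- msupp x) x@_t *: (<< t >> : lin_span K T).
  rewrite [LHS]monalgE; apply: eq_bigr => t _.
  by apply/malgP => u; rewrite mcoeffZ !mcoeffU mulr_natr.
rewrite -[g]/(gl : _ -> _) -[h]/(hl : _ -> _) !linear_sum.
by apply: eq_bigr => t _; rewrite !linearZ /= gh.
Qed.

End LinearExtension.

Lemma eq_lin_ext (K : fieldType) (V : lmodType K) (T : choiceType)
    (f g : T -> V) (x : lin_span K T) : f =1 g -> lin_ext f x = lin_ext g x.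
Proof. by move=> fg; apply: eq_bigr => t _; rewrite fg. Qed.

Lemma lin_ext_linearf (K : fieldType) (V : lmodType K) (T : choiceType)
    (a : K) (f g : T -> V) (x : lin_span K T) :
  lin_ext (fun t => a *: f t + g t) x = a *: lin_ext f x + lin_ext g x.
Proof.
rewrite /lin_ext scaler_sumr -big_split /=; apply: eq_bigr => t _.
by rewrite scalerDr !scalerA mulrC.
Qed.

Section BilinearExtension.
Variables (K : fieldType) (T U : choiceType) (f : T -> U -> K).

Definition bilin_ext (x : lin_span K T) (y : lin_span K U) : K :=
  \sum_(t <- msupp x) \sum_(u <- msupp y) x@_t * y@_u * f t u.

Lemma bilin_extU t u : bilin_ext << t >> << u >> = f t u.
Proof.
by rewrite /bilin_ext !msuppU oner_eq0 !big_seq_fset1 !mcoeffUU !mul1r.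
Qed.

End BilinearExtension.

Section LinearizedOperad.
Variables (K : fieldType) (P : set_operad).

Definition so_at (n : nat) : choiceType := {x : P | so_arity x == n}.

Definition so_unit_at : so_at 1 :=
  Sub (so_unit P) (introT eqP (so_arity_unit P)).

Fact so_comp_atP n m (x : so_at n) (i : 'I_n) (y : so_at m) :
  so_arity (so_comp (val x) i (val y)) == (n + m).-1.
Proof.
case: x y => [x /= /eqP xn] [y /= /eqP ym].
by rewrite so_arity_comp xn ?ym.
Qed.

Definition so_comp_at n m (x : so_at n) (i : 'I_n) (y : so_at m) :
  so_at (n + m).-1 := Sub (so_comp (val x) i (val y)) (so_comp_atP x i y).

Definition lin_sort (n : nat) : lmodType K := lin_span K (so_at n).

Definition lin_comp n m (x : lin_sort n) (i : 'I_n) (y : lin_sort m) :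
    lin_sort (n + m).-1 :=
  lin_ext (fun s => lin_ext (fun t => << so_comp_at s i t >>) y) x.

Lemma lin_compU n m (s : so_at n) (i : 'I_n) (t : so_at m) :
  lin_comp << s >> i << t >> = << so_comp_at s i t >>.
Proof. by rewrite /lin_comp !lin_extU. Qed.

Fact lin_comp_linearl n m (i : 'I_n) (y : lin_sort m) :
  linear (fun x => lin_comp x i y).
Proof. exact: lin_ext_linear. Qed.

Fact lin_comp_linearr n m (x : lin_sort n) (i : 'I_n) :
  linear (@lin_comp n m x i).
Proof.
move=> a y y'; rewrite /lin_comp -lin_ext_linearf; apply: eq_lin_ext => s.
exact: lin_ext_linear.
Qed.

Definition lin_unit : lin_sort 1 := << so_unit_at >>.

Lemma lin_castU m n (e : m = n) (t : so_at m) :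
  ncast (O := lin_sort) e << t >> = << ncast (O := so_at) e t >>.
Proof. by case: n / e. Qed.

Lemma lin_cast_linear m n (e : m = n) : linear (@ncast lin_sort m n e).
Proof. by case: n / e. Qed.

Lemma val_so_cast m n (e : m = n) (t : so_at m) : val (ncast (O := so_at) e t) = val t.
Proof. by case: n / e. Qed.

Lemma so_at_arity n (x : so_at n) : so_arity (val x) = n.
Proof. exact: eqP (valP x). Qed.

Lemma ord_so_arity n (x : so_at n) (i : 'I_n) : (i < so_arity (val x))%N.
Proof. by rewrite so_at_arity. Qed.

Lemma linear_id (V : lmodType K) : linear (@id V). Proof. by []. Qed.

Lemma linear_comp (U V W : lmodType K) (g : V -> W) (f : U -> V) :
  linear g -> linear f -> linear (fun x => g (f x)).
Proof. by move=> lg lf a x y; rewrite lf lg. Qed.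

Fact lin_unitl n (x : lin_sort n) : lin_comp lin_unit ord0 x = x.
Proof.
move: x; apply: lin_span_eq => [||t]; first exact: lin_comp_linearr.
  exact: linear_id.
by rewrite lin_compU; congr << _ >>; apply: val_inj; apply: so_unitl.
Qed.

Fact lin_unitr n (x : lin_sort n) (i : 'I_n) (e : (n + 1).-1 = n) :
  ncast (O := lin_sort) e (lin_comp x i lin_unit) = x.
Proof.
move: x; apply: lin_span_eq => [||t].
- by apply: linear_comp; [apply: lin_cast_linear | apply: lin_comp_linearl].
- exact: linear_id.
rewrite lin_compU lin_castU; congr << _ >>; apply: val_inj.
by rewrite val_so_cast /= so_unitr // ord_so_arity.
Qed.

Fact lin_compA n m l (x : lin_sort n) (y : lin_sort m) (z : lin_sort l)
    (i : 'I_n) (j : 'I_m) (k : 'I_(n + m).-1)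
    (e : ((n + m).-1 + l).-1 = (n + (m + l).-1).-1) :
  k = (i + j)%N :> nat ->
  ncast (O := lin_sort) e (lin_comp (lin_comp x i y) k z)
    = lin_comp x i (lin_comp y j z).
Proof.
move=> eqk; move: x; apply: lin_span_eq => [||s].
- apply: linear_comp; first exact: lin_cast_linear.
  by apply: linear_comp; apply: lin_comp_linearl.
- exact: lin_comp_linearl.
move: y; apply: lin_span_eq => [||t].
- apply: linear_comp; first exact: lin_cast_linear.
  by apply: linear_comp; [apply: lin_comp_linearl | apply: lin_comp_linearr].
- by apply: linear_comp; [apply: lin_comp_linearr | apply: lin_comp_linearl].
move: z; apply: lin_span_eq => [||u].
- by apply: linear_comp; [apply: lin_cast_linear | apply: lin_comp_linearr].
- by apply: linear_comp; apply: lin_comp_linearr.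
rewrite !lin_compU lin_castU; congr << _ >>; apply: val_inj.
by rewrite val_so_cast /= eqk so_compA ?ord_so_arity.
Qed.

Fact lin_compC n m l (x : lin_sort n) (y : lin_sort m) (z : lin_sort l)
    (i j : 'I_n) (k : 'I_(n + m).-1) (i' : 'I_(n + l).-1)
    (e : ((n + m).-1 + l).-1 = ((n + l).-1 + m).-1) :
  (i < j)%N -> k = (j + m).-1 :> nat -> i' = i :> nat ->
  ncast (O := lin_sort) e (lin_comp (lin_comp x i y) k z)
    = lin_comp (lin_comp x j z) i' y.
Proof.
move=> ltij eqk eqi; move: x; apply: lin_span_eq => [||s].
- apply: linear_comp; first exact: lin_cast_linear.
  by apply: linear_comp; apply: lin_comp_linearl.
- by apply: linear_comp; apply: lin_comp_linearl.
move: y; apply: lin_span_eq => [||t].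
- apply: linear_comp; first exact: lin_cast_linear.
  by apply: linear_comp; [apply: lin_comp_linearl | apply: lin_comp_linearr].
- exact: lin_comp_linearr.
move: z; apply: lin_span_eq => [||u].
- by apply: linear_comp; [apply: lin_cast_linear | apply: lin_comp_linearr].
- by apply: linear_comp; [apply: lin_comp_linearl | apply: lin_comp_linearr].
rewrite !lin_compU lin_castU; congr << _ >>; apply: val_inj.
rewrite val_so_cast /= eqk eqi -[m in (j + m)%N](so_at_arity t).
by rewrite so_compC ?ord_so_arity.
Qed.

Definition lin_operad : operad K :=
  Operad lin_comp_linearl lin_comp_linearr lin_unitl lin_unitr
    lin_compA lin_compC.

End LinearizedOperad.

(* Locked because comparing two distinct basis vectors by unfolding finitely
   supported functions makes unification diverge. *)
HB.lock Definition lin_basis (K : fieldType) (P : set_operad) n (t : so_at P n) :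
  lin_operad K P n := << t >>.
Canonical lin_basis_unlockable := Unlockable lin_basis.unlock.

Arguments lin_basis K {P n} t.

Section LinearizedOperadBasis.
Variables (K : fieldType) (P : set_operad).

Lemma op_comp_basis n m (s : so_at P n) (i : 'I_n) (t : so_at P m) :
  op_comp (lin_basis K s) i (lin_basis K t) = lin_basis K (so_comp_at s i t).
Proof. by rewrite unlock; apply: lin_compU. Qed.

Lemma op_unit_basis : op_unit (lin_operad K P) = lin_basis K (so_unit_at P).
Proof. by rewrite unlock. Qed.

Lemma lin_operad_eq (V : lmodType K) n (f g : lin_operad K P n -> V) :
  linear f -> linear g ->
  (forall t, f (lin_basis K t) = g (lin_basis K t)) -> f =1 g.
Proof.
move=> linf ling fg; apply: lin_span_eq linf ling _ => t.
by have := fg t; rewrite unlock.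
Qed.

End LinearizedOperadBasis.

Inductive syntax_tree (G : Type) :=
  BLeaf | BNode of G & syntax_tree G & syntax_tree G.

Arguments BLeaf {G}.
Arguments BNode {G} g l r.

Section SyntaxTreeChoice.
Variable G : choiceType.

Fixpoint syntax_tree_code (t : syntax_tree G) : GenTree.tree G :=
  match t with
  | BLeaf => GenTree.Node 0 [::]
  | BNode g l r =>
      GenTree.Node 0 [:: GenTree.Leaf g; syntax_tree_code l; syntax_tree_code r]
  end.

Fixpoint syntax_tree_decode (c : GenTree.tree G) : syntax_tree G :=
  match c with
  | GenTree.Node _ [:: GenTree.Leaf g; l; r] =>
      BNode g (syntax_tree_decode l) (syntax_tree_decode r)
  | _ => BLeaf
  end.

Lemma syntax_tree_codeK : cancel syntax_tree_code syntax_tree_decode.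
Proof. by elim=> //= g l -> r ->. Qed.

HB.instance Definition _ := Choice.copy (syntax_tree G) (can_type syntax_tree_codeK).

End SyntaxTreeChoice.

Section SyntaxTreeOperad.
Variable G : choiceType.
Implicit Types s t u : syntax_tree G.

Fixpoint syntax_leaves t : nat :=
  match t with
  | BLeaf => 1
  | BNode _ l r => syntax_leaves l + syntax_leaves r
  end.

Fixpoint syntax_graft s (i : nat) t : syntax_tree G :=
  match s with
  | BLeaf => t
  | BNode g l r =>
      if (i < syntax_leaves l)%N then BNode g (syntax_graft l i t) r
      else BNode g l (syntax_graft r (i - syntax_leaves l) t)
  end.

Lemma syntax_leaves_gt0 t : (0 < syntax_leaves t)%N.
Proof. by elim: t => //= g l IHl r _; rewrite addn_gt0 IHl. Qed.

Fact syntax_leaves_graft s i t : (i < syntax_leaves s)%N ->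
  syntax_leaves (syntax_graft s i t) = (syntax_leaves s + syntax_leaves t).-1.
Proof.
elim: s i => [|g l IHl r IHr] i //= lti; case: ltnP => [il|li] /=.
  by rewrite IHl //; have := syntax_leaves_gt0 l; lia.
by rewrite IHr; have := syntax_leaves_gt0 r; lia.
Qed.

Fact syntax_unitr s i : (i < syntax_leaves s)%N -> syntax_graft s i BLeaf = s.
Proof.
elim: s i => [|g l IHl r IHr] i //= lti; case: ltnP => [il|li].
  by rewrite IHl.
by rewrite IHr //; lia.
Qed.

Fact syntax_graftA s t u i j :
  (i < syntax_leaves s)%N -> (j < syntax_leaves t)%N ->
  syntax_graft (syntax_graft s i t) (i + j) u
    = syntax_graft s i (syntax_graft t j u).
Proof.
move=> + ltj; elim: s i => [|g l IHl r IHr] i //= lti.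
  by case: i lti.
case: (ltnP i) => [il|li] /=.
  rewrite syntax_leaves_graft // IHl //.
  by case: ltnP => //; lia.
have -> : (i + j < syntax_leaves l)%N = false by lia.
by rewrite -addnBAC // IHr //; lia.
Qed.

Fact syntax_graftC s t u i j : (i < j)%N -> (j < syntax_leaves s)%N ->
  syntax_graft (syntax_graft s i t) (j + syntax_leaves t).-1 u
    = syntax_graft (syntax_graft s j u) i t.
Proof.
have tgt0 := syntax_leaves_gt0 t; have ugt0 := syntax_leaves_gt0 u.
elim: s i j => [|g l IHl r IHr] i j ltij /= ltj; first by lia.
case: (ltnP j) => [jl|lj].
  rewrite (ltn_trans ltij jl) /= !syntax_leaves_graft //; last by lia.
  have -> : ((j + syntax_leaves t).-1
              < (syntax_leaves l + syntax_leaves t).-1)%N by lia.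
  have -> : (i < (syntax_leaves l + syntax_leaves u).-1)%N by lia.
  by rewrite IHl.
case: (ltnP i) => [il|li] /=; rewrite ?il.
  rewrite syntax_leaves_graft //.
  case: ltnP => [|_]; first by lia.
  by congr (BNode _ _ (syntax_graft _ _ _)); lia.
case: ltnP => [|_]; first by lia.
case: ltnP => [|_]; first by lia.
by rewrite -IHr; first (congr (BNode _ _ (syntax_graft _ _ _)); lia); lia.
Qed.

Definition syntax_set_operad : set_operad :=
  @SetOperad (syntax_tree G) syntax_leaves BLeaf syntax_graft
    erefl syntax_leaves_graft (fun=> erefl) syntax_unitr
    syntax_graftA syntax_graftC.

End SyntaxTreeOperad.

Definition free_operad (K : fieldType) (G : choiceType) : operad K :=
  lin_operad K (syntax_set_operad G).

Definition generator (K : fieldType) (G : choiceType) (g : G) :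
    free_operad K G 2%N :=
  lin_basis K (Sub (BNode g BLeaf BLeaf) isT : so_at (syntax_set_operad G) 2).

Section Quadratic.
Variables (K : fieldType) (G : choiceType).
Local Notation Free3 := (free_operad K G 3%N).

Definition in_span (V : lmodType K) (S : V -> Prop) (x : V) : Prop :=
  exists n (c : 'I_n -> K) (v : 'I_n -> V),
    (forall i, S (v i)) /\ x = \sum_(i < n) c i *: v i.

Definition quadratic_operad (R : Free3 -> Prop) : operad K :=
  quotient_operad (gen_ideal R).

(* The syntax trees of arity 3 are the compositions g o_1 h, encoded by
   BNode g (BNode h BLeaf BLeaf) BLeaf, and g o_2 h, encoded by
   BNode g BLeaf (BNode h BLeaf BLeaf). *)
Definition koszul_form_tree (s t : syntax_tree G) : K :=
  match s, t with
  | BNode g (BNode h BLeaf BLeaf) BLeaf, BNode g' (BNode h' BLeaf BLeaf) BLeaf =>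
      ((g == g') && (h == h'))%:R
  | BNode g BLeaf (BNode h BLeaf BLeaf), BNode g' BLeaf (BNode h' BLeaf BLeaf) =>
      - ((g == g') && (h == h'))%:R
  | _, _ => 0
  end.

Definition koszul_form (x y : Free3) : K :=
  bilin_ext (fun s t => koszul_form_tree (val s) (val t)) x y.

Lemma koszul_form_generators g h g' h' (i i' : 'I_2) :
  koszul_form (op_comp (generator K g) i (generator K h))
              (op_comp (generator K g') i' (generator K h'))
  = if [&& g == g', h == h' & i == i'] then (-1) ^+ i else 0.
Proof.
rewrite /generator !op_comp_basis /koszul_form !unlock bilin_extU !SubK.
case: i => -[|[]] // i2; case: i' => -[|[]] // i2'; rewrite /= -val_eqE /=;
  by case: eqP; case: eqP; rewrite ?oppr0 ?expr0 ?expr1.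
Qed.

Definition annihilator (R : Free3 -> Prop) (y : Free3) : Prop :=
  forall x, R x -> koszul_form x y = 0.

End Quadratic.

Section AsDAs.
Variables (K : fieldType) (gamma : nat).

(* The set {1, ..., gamma} is encoded by 'I_gamma through a |-> a - 1, which
   is increasing. *)
Definition ord_maxn (a b : 'I_gamma) : 'I_gamma := if (a < b)%N then b else a.

Local Notation star a := (generator K (a : 'I_gamma)).
Local Notation "x ∘1 y" := (op_comp x (ord0 : 'I_2) y) (at level 40).
Local Notation "x ∘2 y" := (op_comp x (ord_max : 'I_2) y) (at level 40).

Inductive As_generating_relation : free_operad K 'I_gamma 3%N -> Prop :=
  | As_relation1 a b : As_generating_relation
      (star a ∘1 star b - star (ord_maxn a b) ∘2 star (ord_maxn a b))
  | As_relation2 a b : As_generating_relation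
      (star a ∘2 star b - star (ord_maxn a b) ∘2 star (ord_maxn a b)).

Definition As_relations : free_operad K 'I_gamma 3%N -> Prop :=
  in_span As_generating_relation.

Definition As_operad : operad K := quadratic_operad As_relations.

Definition DAs_operad : operad K := quadratic_operad (annihilator As_relations).

End AsDAs.

Inductive labelled_tree (L : Type) :=
  SLeaf | SNode of L & seq (labelled_tree L).

Arguments SLeaf {L}.
Arguments SNode {L} a ts.

Section LabelledTreeInd.
Variables (L : Type) (Q : labelled_tree L -> Prop).
Hypothesis Q_leaf : Q SLeaf.
Hypothesis Q_node : forall a ts, foldr (fun t => and (Q t)) True ts -> Q (SNode a ts).

Fixpoint labelled_tree_nested_ind t : Q t :=
  match t with
  | SLeaf => Q_leaf
  | SNode a ts => Q_node a
      ((fix all_Q ts : foldr (fun t => and (Q t)) True ts :=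
          match ts with
          | [::] => I
          | t :: ts' => conj (labelled_tree_nested_ind t) (all_Q ts')
          end) ts)
  end.

End LabelledTreeInd.

Section LabelledTreeChoice.
Variable L : choiceType.

Fixpoint labelled_tree_code (t : labelled_tree L) : GenTree.tree L :=
  match t with
  | SLeaf => GenTree.Node 0 [::]
  | SNode a ts => GenTree.Node 0 (GenTree.Leaf a :: map labelled_tree_code ts)
  end.

Fixpoint labelled_tree_decode (c : GenTree.tree L) : labelled_tree L :=
  match c with
  | GenTree.Node _ (GenTree.Leaf a :: cs) => SNode a (map labelled_tree_decode cs)
  | _ => SLeaf
  end.

Lemma labelled_tree_codeK : cancel labelled_tree_code labelled_tree_decode.
Proof.
elim/labelled_tree_nested_ind => //= a ts IHts; congr SNode.
by elim: ts IHts => //= t ts IH [-> /IH ->].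
Qed.

HB.instance Definition _ :=
  Choice.copy (labelled_tree L) (can_type labelled_tree_codeK).

End LabelledTreeChoice.

Section AlternatingTrees.
Variable L : choiceType.
Implicit Types (s t u : labelled_tree L) (ss ts : seq (labelled_tree L)).

Definition is_leaf t := if t is SLeaf then true else false.

Definition root_label t : option L := if t is SNode a _ then Some a else None.

Definition children t := if t is SNode _ ts then ts else [::].

Fixpoint leaves t : nat :=
  match t with
  | SLeaf => 1
  | SNode _ ts => sumn (map leaves ts)
  end.

Fixpoint is_schroeder t : bool :=
  match t with
  | SLeaf => true
  | SNode _ ts => (2 <= size ts)%N && all is_schroeder ts
  end.

Fixpoint is_alternating t : bool :=
  match t with
  | SLeaf => true
  | SNode a ts =>
      all (fun t => (root_label t != Some a) && is_alternating t) ts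
  end.

(* What replaces a leaf x in the list of children of its father, labelled a,
   when t is grafted on x and the new edge is contracted if t is rooted at a
   node labelled a too. *)
Definition splice (a : L) t : seq (labelled_tree L) :=
  if root_label t == Some a then children t else [:: t].

(* [graft_contract s i t] grafts t on the leaf of s numbered i, counting leaves
   from left to right and from 0, and contracts the edge between the father of
   this leaf and the root of t when both have the same label.  The inner
   function acts on the list of children of a node labelled a. *)
Fixpoint graft_contract s (i : nat) t {struct s} : labelled_tree L :=
  match s with
  | SLeaf => t
  | SNode a ss =>
      SNode a
        ((fix graft_forest ss (i : nat) {struct ss} :=
            match ss with
            | [::] => [::]
            | u :: us =>
                if (i < leaves u)%N then
                  (if is_leaf u then splice a t else [:: graft_contract u i t])
                    ++ us
                else u :: graft_forest us (i - leaves u)%N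
            end) ss i)
  end.

Fixpoint graft_forest (a : L) ss (i : nat) t :=
  match ss with
  | [::] => [::]
  | u :: us =>
      if (i < leaves u)%N then
        (if is_leaf u then splice a t else [:: graft_contract u i t]) ++ us
      else u :: graft_forest a us (i - leaves u)%N t
  end.

Lemma graft_contract_node a ss i t :
  graft_contract (SNode a ss) i t = SNode a (graft_forest a ss i t).
Proof.
rewrite /=; congr SNode.
by elim: ss i => //= u us IH i; rewrite IH.
Qed.

Local Notation fleaves ss := (sumn (map leaves ss)).

Lemma fleaves_cat ss ts : fleaves (ss ++ ts) = (fleaves ss + fleaves ts)%N.
Proof. by rewrite map_cat sumn_cat. Qed.

Lemma fleaves_splice a t : fleaves (splice a t) = leaves t.
Proof. by rewrite /splice; case: t => [|b ts] //=; case: eqP => //= _; rewrite addn0. Qed.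

Lemma fleaves_subst a u i t :
  leaves (graft_contract u i t) = (leaves u + leaves t).-1 ->
  fleaves (if is_leaf u then splice a t else [:: graft_contract u i t])
    = (leaves u + leaves t).-1.
Proof.
case: u => [|b us] IH; first by rewrite fleaves_splice add1n.
by rewrite [LHS]/= -[RHS]IH /= addn0.
Qed.

Fact leaves_graft s i t : (i < leaves s)%N ->
  leaves (graft_contract s i t) = (leaves s + leaves t).-1.
Proof.
elim/labelled_tree_nested_ind: s i => [i _|a ss IHss i]; first by rewrite add1n.
rewrite graft_contract_node /=.
elim: ss IHss i => //= u us IH [IHu IHus] i lti.
case: ltnP => [iu|ui].
  by rewrite fleaves_cat fleaves_subst; [lia | apply: IHu].
by rewrite /= IH //; lia.
Qed.

Lemma graft_forest_cat a ss ts i t :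
  graft_forest a (ss ++ ts) i t
    = if (i < fleaves ss)%N then graft_forest a ss i t ++ ts
      else ss ++ graft_forest a ts (i - fleaves ss)%N t.
Proof.
elim: ss i => [|u us IH] i /=; first by rewrite subn0.
case: (ltnP i (leaves u)) => [iu|ui]; first by rewrite ltn_addr // catA.
rewrite IH ltn_subLR // subnDA; case: ifP => //.
Qed.

Lemma graft_forest1 a u i t : (i < leaves u)%N ->
  graft_forest a [:: u] i t
    = if is_leaf u then splice a t else [:: graft_contract u i t].
Proof. by move=> /= ->; rewrite cats0. Qed.

Lemma graft_forest_splice a t j u : (j < leaves t)%N ->
  graft_forest a (splice a t) j u = splice a (graft_contract t j u).
Proof.
case: t => [|b ts] ltj; first by rewrite graft_forest1.
rewrite graft_contract_node /splice [root_label _]/= [root_label _]/=.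
by case: eqP => [[->] //|_]; rewrite graft_forest1 // graft_contract_node.
Qed.

Fact graft_contract_leaf s i : (i < leaves s)%N -> graft_contract s i SLeaf = s.
Proof.
elim/labelled_tree_nested_ind: s i => [//|a ss IHss i lti].
rewrite graft_contract_node; congr SNode.
elim: ss IHss i lti => // u us IH [IHu IHus] i; rewrite [leaves _]/= => lti.
rewrite [LHS]/=; case: ltnP => [iu|ui]; last by rewrite IH //=; lia.
by case: u IHu iu {lti} => // b us' IHu iu; rewrite [is_leaf _]/= IHu.
Qed.

Fact graft_contractA s t u i j : (i < leaves s)%N -> (j < leaves t)%N ->
  graft_contract (graft_contract s i t) (i + j) u
    = graft_contract s i (graft_contract t j u).
Proof.
move=> + ltj.
elim/labelled_tree_nested_ind: s i => [|a ss IHss] i; first by case: i.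
rewrite [leaves _]/= => lti; rewrite !graft_contract_node; congr SNode.
elim: ss IHss i lti => //= v vs IH [IHv IHvs] i lti.
case: ltnP => [iv|vi].
  rewrite graft_forest_cat fleaves_subst; last exact: leaves_graft.
  rewrite ifT; last by lia.
  congr (_ ++ _); case: v IHv iv {lti} => [|b us] IHv iv.
    by case: i iv => //= _; rewrite graft_forest_splice.
  rewrite [is_leaf _]/= graft_forest1; last by rewrite leaves_graft //; lia.
  by rewrite -IHv // graft_contract_node.
rewrite /= ifF; last by lia.
by rewrite -addnBAC // IH //; lia.
Qed.

Lemma leaves_gt0 t : is_schroeder t -> (0 < leaves t)%N.
Proof.
elim/labelled_tree_nested_ind: t => //= a [|t ts] //= [IHt _].
by case/and3P => _ /IHt tgt0 _; lia.
Qed.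

Fact graft_contractC s t u i j : is_schroeder t -> is_schroeder u ->
  (i < j)%N -> (j < leaves s)%N ->
  graft_contract (graft_contract s i t) (j + leaves t).-1 u
    = graft_contract (graft_contract s j u) i t.
Proof.
move=> /leaves_gt0 tgt0 /leaves_gt0 ugt0.
elim/labelled_tree_nested_ind: s i j => [|a ss IHss] i j ltij.
  by case: j ltij.
rewrite [leaves _]/= => ltj; rewrite !graft_contract_node; congr SNode.
elim: ss IHss i j ltij ltj => //= v vs IH [IHv IHvs] i j ltij ltj.
case: (ltnP j (leaves v)) => [jv|vj].
  have iv : (i < leaves v)%N by lia.
  rewrite iv !graft_forest_cat !fleaves_subst; try exact: leaves_graft.
  have -> : ((j + leaves t).-1 < (leaves v + leaves t).-1)%N by lia.
  have -> : (i < (leaves v + leaves u).-1)%N by lia.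
  congr (_ ++ _); case: v IHv iv jv {ltj} => [|b us] IHv iv jv; first by move: jv => /=; lia.
  rewrite [is_leaf _]/= !graft_forest1; try by rewrite leaves_graft //; lia.
  by rewrite IHv // graft_contract_node.
case: (ltnP i (leaves v)) => [iv|vi].
  rewrite graft_forest_cat fleaves_subst; last exact: leaves_graft.
  have -> : ((j + leaves t).-1 < (leaves v + leaves t).-1)%N = false by lia.
  rewrite /= iv; congr (_ ++ graft_forest _ _ _ _); lia.
have vj' : (leaves v <= (j + leaves t).-1)%N by lia.
rewrite /= !ltnNge vj' vi /= -IH //; try lia.
by congr (_ :: graft_forest _ _ _ _); lia.
Qed.

Lemma size_splice a t : is_schroeder t -> (0 < size (splice a t))%N.
Proof. by rewrite /splice; case: t => //= b ts /andP[sz _]; case: eqP => //= _; lia. Qed.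

Lemma all_splice_schroeder a t : is_schroeder t -> all is_schroeder (splice a t).
Proof. by rewrite /splice; case: eqP => [|_ /= ->//]; case: t => //= b ts _ /andP[]. Qed.

Lemma schroeder_graft s i t :
  is_schroeder s -> is_schroeder t -> is_schroeder (graft_contract s i t).
Proof.
move=> + st; elim/labelled_tree_nested_ind: s i => // a ss IHss i.
rewrite graft_contract_node.
move=> /= /andP[sz sss]; apply/andP; split.
  apply: leq_trans sz _; elim: ss {IHss sss} i => //= v vs IH i.
  case: ifP => _; last by rewrite /= ltnS IH.
  rewrite size_cat -add1n leq_add2r; case: ifP => // _.
  exact: size_splice.
elim: ss IHss i {sz} sss => //= v vs IH [IHv IHvs] i /andP[sv svs].
case: ifP => _ /=; last by rewrite sv IH.
rewrite all_cat svs andbT; case: ifP => _; first exact: all_splice_schroeder.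
by rewrite /= IHv.
Qed.

Lemma all_splice_alternating a t : is_alternating t ->
  all (fun t => (root_label t != Some a) && is_alternating t) (splice a t).
Proof.
rewrite /splice; case: eqP => [|/eqP ta /= ->]; last by rewrite ta.
by case: t => //= b ts [->].
Qed.

Lemma alternating_graft s i t :
  is_alternating s -> is_alternating t -> is_alternating (graft_contract s i t).
Proof.
move=> + st; elim/labelled_tree_nested_ind: s i => // a ss IHss i.
rewrite graft_contract_node.
rewrite /=; elim: ss IHss i => //= v vs IH [IHv IHvs] i /andP[/andP[va sv] svs].
case: ifP => _ /=; last by rewrite va sv IH.
rewrite all_cat svs andbT; case: v va sv IHv => [|b us] va sv IHv /=.
  exact: all_splice_alternating.
by rewrite andbT; apply/andP; split => //; apply: IHv.
Qed.

End AlternatingTrees.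

Section AlternatingSchroederOperad.
Variable gamma : nat.

Definition alt_schroeder_tree : choiceType :=
  {t : labelled_tree 'I_gamma | is_schroeder t && is_alternating t}.

Implicit Types s t u : alt_schroeder_tree.

Definition alt_leaf : alt_schroeder_tree := Sub SLeaf isT.

Definition alt_leaves t : nat := leaves (val t).

Fact alt_graftP s i t :
  let r := graft_contract (val s) i (val t) in
  is_schroeder r && is_alternating r.
Proof.
case: s t => [s /= /andP[ss sa]] [t /= /andP[ts ta]].
by rewrite schroeder_graft ?alternating_graft.
Qed.

Definition alt_graft s i t : alt_schroeder_tree :=
  Sub (graft_contract (val s) i (val t)) (alt_graftP s i t).

Fact alt_leaves_graft s i t : (i < alt_leaves s)%N ->
  alt_leaves (alt_graft s i t) = (alt_leaves s + alt_leaves t).-1.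
Proof. exact: leaves_graft. Qed.

Fact alt_unitl t : alt_graft alt_leaf 0 t = t.
Proof. exact: val_inj. Qed.

Fact alt_unitr s i : (i < alt_leaves s)%N -> alt_graft s i alt_leaf = s.
Proof. by move=> lti; apply: val_inj; apply: graft_contract_leaf. Qed.

Fact alt_graftA s t u i j : (i < alt_leaves s)%N -> (j < alt_leaves t)%N ->
  alt_graft (alt_graft s i t) (i + j) u = alt_graft s i (alt_graft t j u).
Proof. by move=> lti ltj; apply: val_inj; apply: graft_contractA. Qed.

Fact alt_graftC s t u i j : (i < j)%N -> (j < alt_leaves s)%N ->
  alt_graft (alt_graft s i t) (j + alt_leaves t).-1 u
    = alt_graft (alt_graft s j u) i t.
Proof.
move=> ltij ltj; apply: val_inj; apply: graft_contractC => //.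
  by case/andP: (valP t).
by case/andP: (valP u).
Qed.

Definition alt_schroeder_set_operad : set_operad :=
  @SetOperad alt_schroeder_tree alt_leaves alt_leaf alt_graft
    erefl alt_leaves_graft alt_unitl alt_unitr alt_graftA alt_graftC.

End AlternatingSchroederOperad.

Definition alt_tree gamma n (s : so_at (alt_schroeder_set_operad gamma) n) :
  labelled_tree 'I_gamma := val (val s).

Definition alt_schroeder_operad (K : fieldType) (gamma : nat) : operad K :=
  lin_operad K (alt_schroeder_set_operad gamma).

(* Main.v *)
(* The annihilator of the relations of As is spanned by the elements
   sum_{max(a,b) = m} (star_a o_1 star_b - star_a o_2 star_b). Summing over
   m <= k gives the associator of diamond_k := sum_{a <= k} star_a, so the
   diamonds are associative in DAs and a Schroeder tree can be evaluated there by
   reading a node labelled a with k children as the (k-1)-fold product for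
   diamond_a; associativity makes this compatible with edge contraction.
   Conversely, star_a is sent to the difference of the corollas labelled a and
   a - 1, and the relations telescope to 0 because corollas are associative.
   Both maps are operad morphisms and are inverse to each other on generators. *)

Require Import Defs.
From HB Require Import structures.
From mathcomp Require Import all_boot all_order all_algebra.
From mathcomp Require Import boolp zify.

Set Implicit Arguments.
Unset Strict Implicit.
Unset Printing Implicit Defensive.

Import GRing.Theory.
Local Open Scope ring_scope.

(** * Functions given with a separate proof of linearity *)

Definition linear_of (K : fieldType) (U V : lmodType K) (f : U -> V)
    (lf : linear f) : {linear U -> V} :=
  HB.pack_for {linear U -> V} f (GRing.isLinear.Build K U V *:%R f lf).

Section LinearFacts.
Variables (K : fieldType) (U V : lmodType K) (f : U -> V).
Hypothesis lf : linear f.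

Lemma lin_fun0 : f 0 = 0.
Proof. exact: (linear0 (linear_of lf)). Qed.

Lemma lin_funB x y : f (x - y) = f x - f y.
Proof. exact: (linearB (linear_of lf)). Qed.

Lemma lin_funZ a x : f (a *: x) = a *: f x.
Proof. exact: (linearZ_LR (linear_of lf)). Qed.

Lemma lin_fun_sum (I : Type) (r : seq I) (P : pred I) (E : I -> U) :
  f (\sum_(i <- r | P i) E i) = \sum_(i <- r | P i) f (E i).
Proof. exact: (linear_sum (linear_of lf)). Qed.

End LinearFacts.

(** * Total space of an operad and iterated binary products *)

Section TotalSpace.
Variables (K : fieldType) (O : operad K).

(* In the total space the laws of an operad hold without casts. *)
Definition total := {n : nat & O n}.

Definition tot n (x : O n) : total := Tagged (op_sort O) x.

(** The position is a plain natural number, because the arity of [X] is no longer visible in its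
    type. An index out of range returns [X]. *)
Definition tcomp (X : total) (i : nat) (Y : total) : total :=
  if insub i is Some j then tot (op_comp (tagged X) (j : 'I_(tag X)) (tagged Y))
  else X.

Implicit Types X Y Z : total.

Lemma tot_inj n : injective (@tot n).
Proof. by move=> x y; apply: eq_from_Tagged. Qed.

Lemma tot_cast m n (e : m = n) (x : O m) : tot (ncast (O := op_sort O) e x) = tot x.
Proof. by case: n / e. Qed.

Lemma tcompE n m (x : O n) (i : 'I_n) (y : O m) :
  tcomp (tot x) i (tot y) = tot (op_comp x i y).
Proof. by rewrite /tcomp /= valK. Qed.

Lemma tag_tcomp X i Y : (i < tag X)%N ->
  tag (tcomp X i Y) = (tag X + tag Y).-1.
Proof. by move=> lti; rewrite /tcomp insubT. Qed.

Lemma tcomp_unitl X : tcomp (tot (op_unit O)) 0 X = X.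
Proof.
by case: X => n x; rewrite -[0%N]/(val (ord0 : 'I_1)) tcompE op_unitl.
Qed.

Lemma tcomp_unitr X i : (i < tag X)%N -> tcomp X i (tot (op_unit O)) = X.
Proof.
case: X => n x lti; have e : (n + 1).-1 = n by rewrite addn1.
transitivity (tot (op_comp x (Ordinal lti) (op_unit O))); first by rewrite -tcompE.
by rewrite -(tot_cast e) op_unitr.
Qed.

Lemma tcompA X Y Z i j : (i < tag X)%N -> (j < tag Y)%N ->
  tcomp (tcomp X i Y) (i + j) Z = tcomp X i (tcomp Y j Z).
Proof.
case: X Y Z => [n x] [m y] [l z] /= lti ltj.
have ltk : (i + j < (n + m).-1)%N by lia.
have e : ((n + m).-1 + l).-1 = (n + (m + l).-1).-1 by lia.
transitivity (tot (op_comp (op_comp x (Ordinal lti) y) (Ordinal ltk) z)).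
  by rewrite -!tcompE.
transitivity (tot (op_comp x (Ordinal lti) (op_comp y (Ordinal ltj) z))).
  by rewrite -(@op_compA _ _ _ _ _ x y z _ _ (Ordinal ltk) e) ?tot_cast.
by rewrite -!tcompE.
Qed.

Lemma tcompC X Y Z i j : (i < j)%N -> (j < tag X)%N ->
  tcomp (tcomp X i Y) (j + tag Y).-1 Z = tcomp (tcomp X j Z) i Y.
Proof.
case: X Y Z => [n x] [m y] [l z] /= ltij ltj.
have lti : (i < n)%N by lia.
have ltk : ((j + m).-1 < (n + m).-1)%N by lia.
have lti' : (i < (n + l).-1)%N by lia.
have e : ((n + m).-1 + l).-1 = ((n + l).-1 + m).-1 by lia.
transitivity (tot (op_comp (op_comp x (Ordinal lti) y) (Ordinal ltk) z)).
  by rewrite -!tcompE.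
transitivity (tot (op_comp (op_comp x (Ordinal ltj) z) (Ordinal lti') y)).
  by rewrite -(@op_compC _ _ _ _ _ x y z (Ordinal lti) _ (Ordinal ltk) _ e) ?tot_cast.
by rewrite -!tcompE.
Qed.

(** The right argument is grafted first, so that the left one still goes to position 0 whatever the
    arities are. *)
Definition tnode (G X Y : total) : total := tcomp (tcomp G 1 Y) 0 X.

Section Node.
Variable G : total.
Hypothesis G2 : tag G = 2%N.

Lemma tag_tnode X Y : tag (tnode G X Y) = (tag X + tag Y)%N.
Proof. rewrite /tnode !tag_tcomp ?G2 //; lia. Qed.

Lemma tcomp_tnodel X Y Z i : (i < tag X)%N ->
  tcomp (tnode G X Y) i Z = tnode G (tcomp X i Z) Y.
Proof. by move=> lti; rewrite /tnode -tcompA // tag_tcomp G2. Qed.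

Lemma tcomp_tnoder X Y Z i : (tag X <= i)%N -> (i < tag X + tag Y)%N ->
  tcomp (tnode G X Y) i Z = tnode G X (tcomp Y (i - tag X) Z).
Proof.
move=> lei lti; rewrite /tnode -tcompA ?G2 //; last by lia.
(* [Z] goes into [Y], away from [X]: before [X] is inserted at 0, its position in [tcomp G 1 Y] is
   [1 + (i - tag X)]. *)
rewrite -(@tcompC _ X Z 0 (1 + (i - tag X))) ?tag_tcomp ?G2 //; last by lia.
by congr tcomp; lia.
Qed.

Lemma tnodeA X Y Z : tcomp G 0 G = tcomp G 1 G ->
  tnode G X (tnode G Y Z) = tnode G (tnode G X Y) Z.
Proof.
(* The common form is the ternary product of [G] with its inputs filled from right to left, so that
   the remaining positions never move. *)
move=> assocG; rewrite {1 3}/tnode; transitivity (tcomp (tcomp (tcomp (tcomp G 0 G) 2 Z) 1 Y) 0 X).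
  rewrite /tnode -(@tcompA G _ Y 1 0) ?G2 ?tag_tcomp ?G2 //.
  by rewrite -(@tcompA G G Z 1 1) ?G2 // assocG.
have := @tcompC G G Z 0 1; rewrite G2 => -> //.
rewrite -(@tcompA _ (tcomp G 1 Y) X 0 0) ?tag_tcomp ?G2 //.
by rewrite -tcompA // ?tag_tcomp ?G2.
Qed.

(* Junk value on the empty sequence. *)
Fixpoint comb (Xs : seq total) : total :=
  match Xs with
  | [::] => tot (op_unit O)
  | [:: X] => X
  | X :: Xs' => tnode G X (comb Xs')
  end.

Lemma comb_cons X Xs : (0 < size Xs)%N -> comb (X :: Xs) = tnode G X (comb Xs).
Proof. by case: Xs. Qed.

(** This is the algebraic counterpart of edge contraction: associativity lets a block of factors be
    multiplied out before or after it is inserted among its siblings. *)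
Lemma comb_cat Xs Ys : tcomp G 0 G = tcomp G 1 G ->
  (0 < size Xs)%N -> (0 < size Ys)%N ->
  comb (Xs ++ Ys) = tnode G (comb Xs) (comb Ys).
Proof.
move=> assocG; elim: Xs => [//|X [|X' Xs] IH] _ Ys0; first exact: comb_cons.
by rewrite cat_cons comb_cons // IH // tnodeA // -comb_cons.
Qed.

Lemma tag_comb Xs : (0 < size Xs)%N -> tag (comb Xs) = sumn (map tag Xs).
Proof.
elim: Xs => [//|X [|X' Xs] IH] _; first by rewrite /= addn0.
by rewrite comb_cons // tag_tnode IH.
Qed.

End Node.

End TotalSpace.

(** * Operad morphisms and their action on total spaces *)

Section Morphisms.
Variable K : fieldType.

Definition operad_morphism (P Q : operad K)
    (f : forall n, {linear P n -> Q n}) : Prop :=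
  f 1%N (op_unit P) = op_unit Q /\
  forall n m (x : P n) (i : 'I_n) (y : P m),
    f _ (op_comp x i y) = op_comp (f n x) i (f m y).

Definition tmap (P Q : operad K) (f : forall n, {linear P n -> Q n})
    (X : total P) : total Q := tot (f _ (tagged X)).

(** For an index out of range, both compositions fall back to the image of [X]. *)
Lemma tmap_comp (P Q : operad K) (f : forall n, {linear P n -> Q n})
    (X Y : total P) (i : nat) : operad_morphism f ->
  tmap f (tcomp X i Y) = tcomp (tmap f X) i (tmap f Y).
Proof.
move=> [_ fM]; rewrite /tcomp; case: insubP => [j _ _|]; last by [].
by rewrite /tmap /= fM.
Qed.

Lemma tmap_unit (P Q : operad K) (f : forall n, {linear P n -> Q n}) :
  operad_morphism f -> tmap f (tot (op_unit P)) = tot (op_unit Q).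
Proof. by move=> [f1 _]; rewrite /tmap /= f1. Qed.

Lemma operad_morphism_comp (P Q R : operad K)
    (f : forall n, {linear P n -> Q n}) (g : forall n, {linear Q n -> R n}) :
  operad_morphism f -> operad_morphism g ->
  operad_morphism (fun n => linear_of (linear_comp (linearP (g n)) (linearP (f n)))).
Proof.
move=> [f1 fM] [g1 gM]; split=> [|n m x i y] /=; first by rewrite f1 g1.
by rewrite fM gM.
Qed.

End Morphisms.

(** * Morphisms out of a linearized set operad *)

Section BasisMorphism.
Variables (K : fieldType) (P : set_operad) (O : operad K) (f : P -> total O).
Hypothesis tag_f : forall s, tag (f s) = so_arity s.

Definition basis_image n (s : so_at P n) : O n :=
  ncast (O := op_sort O) (etrans (tag_f (val s)) (so_at_arity s)) (tagged (f (val s))).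

Lemma tot_basis_image n (s : so_at P n) : tot (basis_image s) = f (val s).
Proof. by rewrite tot_cast; case: (f _). Qed.

Definition basis_morphism n : {linear lin_operad K P n -> O n} :=
  linear_of (lin_ext_linear (@basis_image n)).

Lemma basis_morphismE n (s : so_at P n) :
  basis_morphism n (lin_basis K s) = basis_image s.
Proof. by rewrite unlock; apply: lin_extU. Qed.

(** Composition is linear in each argument, so multiplicativity is only tested on pairs of basis
    elements, where it can be read in the total space without casts. *)
Lemma basis_morphismP : f (so_unit P) = tot (op_unit O) ->
  (forall s t i, (i < so_arity s)%N ->
     f (so_comp s i t) = tcomp (f s) i (f t)) ->
  operad_morphism basis_morphism.
Proof.
move=> f1 fM; split=> [|n m x i y].
  by rewrite op_unit_basis basis_morphismE; apply: tot_inj; rewrite tot_basis_image.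
move: x; apply: lin_operad_eq => [||s].
- exact: (linear_comp (linearP _) (op_comp_linearl _ _)).
- exact: (linear_comp (op_comp_linearl _ _) (linearP _)).
move: y; apply: lin_operad_eq => [||t].
- exact: (linear_comp (linearP _) (op_comp_linearr _ _)).
- exact: (linear_comp (op_comp_linearr _ _) (linearP _)).
rewrite op_comp_basis !basis_morphismE; apply: tot_inj.
by rewrite -tcompE !tot_basis_image fM // ord_so_arity.
Qed.

End BasisMorphism.

Section TotalBasis.
Variables (K : fieldType) (P : set_operad).

Definition own_component (s : P) : so_at P (so_arity s) := Sub s (eqxx (so_arity s)).

Definition tbasis (s : P) : total (lin_operad K P) :=
  tot (lin_basis K (own_component s)).

Lemma tot_basis n (s : so_at P n) : tot (lin_basis K s) = tbasis (val s).
Proof.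
case: s => s sn; have e := eqP sn; case: n / e sn => sn.
by rewrite /tbasis /own_component (bool_irrelevance sn (eqxx _)).
Qed.

Lemma tbasis_comp s t i : (i < so_arity s)%N ->
  tbasis (so_comp s i t) = tcomp (tbasis s) i (tbasis t).
Proof.
move=> lti; transitivity (tot (op_comp (lin_basis K (own_component s))
    (Ordinal lti) (lin_basis K (own_component t)))); last by rewrite -tcompE.
by rewrite op_comp_basis tot_basis.
Qed.

Lemma tbasis_unit : tbasis (so_unit P) = tot (op_unit (lin_operad K P)).
Proof. by rewrite op_unit_basis tot_basis. Qed.

End TotalBasis.

(** * Factoring a morphism through a quotient operad *)

Section QuotientMorphism.
Variables (K : fieldType) (P Q : operad K) (f : forall n, {linear P n -> Q n}).
Hypothesis fM : operad_morphism f.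

Definition ker_pred n (x : P n) : bool := f n x == 0.

Lemma ker_submod n : submod_closed (@ker_pred n).
Proof.
split=> [|a x y /eqP fx /eqP fy]; apply/eqP; first exact: linear0.
by rewrite linearP fx fy scaler0 addr0.
Qed.

Lemma ker_compl n m (x : P n) (i : 'I_n) (y : P m) :
  ker_pred x -> ker_pred (op_comp x i y).
Proof.
move=> /eqP fx; apply/eqP; rewrite fM.2 fx.
exact: (lin_fun0 (op_comp_linearl _ _)).
Qed.

Lemma ker_compr n m (x : P n) (i : 'I_n) (y : P m) :
  ker_pred y -> ker_pred (op_comp x i y).
Proof.
move=> /eqP fy; apply/eqP; rewrite fM.2 fy.
exact: (lin_fun0 (op_comp_linearr _ _)).
Qed.

Definition ker_ideal : operad_ideal P :=
  OperadIdeal ker_submod ker_compl ker_compr.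

Section Factor.
Variables (k : nat) (R : P k -> Prop).
Hypothesis fR : forall r, R r -> f k r = 0.

Definition quot_factor n (x : quotient_operad (gen_ideal R) n) : Q n :=
  f n (quot_repr x).

(** Two representatives of a class differ by an element of the generated ideal. The kernel of [f] is
    one of the ideals containing [R], so [f] kills this difference. *)
Lemma quot_factor_pi n (x : P n) :
  quot_factor (quot_pi (gen_ideal R) x) = f n x.
Proof.
apply/eqP; rewrite -subr_eq0 /quot_factor -linearB.
have /quot_piP : quot_pi (gen_ideal R) (quot_repr (quot_pi (gen_ideal R) x))
    = quot_pi (gen_ideal R) x by rewrite quot_reprK.
by move=> /asboolP /(_ ker_ideal); apply=> r /fR/eqP.
Qed.

Lemma quot_factor_linear n : linear (@quot_factor n).
Proof.
move=> a x y; have [v ->] := quot_pi_surj x; have [w ->] := quot_pi_surj y.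
by rewrite -quot_pi_linear !quot_factor_pi linearP.
Qed.

Definition quot_morphism n : {linear quotient_operad (gen_ideal R) n -> Q n} :=
  linear_of (@quot_factor_linear n).

Lemma quot_morphism_pi n (x : P n) :
  quot_morphism n (quot_pi (gen_ideal R) x) = f n x.
Proof. exact: quot_factor_pi. Qed.

Lemma quot_morphismP : operad_morphism quot_morphism.
Proof.
split=> [|n m x i y]; first by rewrite quot_morphism_pi fM.1.
have [v ->] := quot_pi_surj x; have [w ->] := quot_pi_surj y.
rewrite -[X in quot_morphism _ X]quot_pi_comp.
by rewrite !quot_morphism_pi fM.2.
Qed.

End Factor.

End QuotientMorphism.

Definition quot_pi_of (K : fieldType) (P : operad K) (I : operad_ideal P) n :
    {linear P n -> quotient_operad I n} :=
  linear_of (@quot_pi_linear K P I n).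

Lemma quot_pi_morphism (K : fieldType) (P : operad K) (I : operad_ideal P) :
  operad_morphism (quot_pi_of I).
Proof. by split=> // n m x i y; apply: quot_pi_comp. Qed.

(** * Universal property of the free operad *)

Section FreeUniversal.
Variables (K : fieldType) (G : choiceType) (Q : operad K) (g : G -> Q 2%N).

Fixpoint tree_eval (t : syntax_tree G) : total Q :=
  match t with
  | BLeaf => tot (op_unit Q)
  | BNode a l r => tnode (tot (g a)) (tree_eval l) (tree_eval r)
  end.

Lemma tag_tree_eval (t : syntax_set_operad G) : tag (tree_eval t) = so_arity t.
Proof. by elim: t => //= a l IHl r IHr; rewrite tag_tnode // IHl IHr. Qed.

Lemma tree_eval_graft (s t : syntax_set_operad G) i : (i < so_arity s)%N ->
  tree_eval (so_comp s i t) = tcomp (tree_eval s) i (tree_eval t).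
Proof.
elim: s i => [|a l IHl r IHr] i /= lti.
  by case: i lti => // _; rewrite tcomp_unitl.
case: ltnP => [il|li] /=.
  by rewrite tcomp_tnodel ?tag_tree_eval // -IHl.
rewrite tcomp_tnoder ?tag_tree_eval // -IHr //=; lia.
Qed.

Definition free_morphism : forall n, {linear free_operad K G n -> Q n} :=
  basis_morphism tag_tree_eval.

Lemma free_morphismP : operad_morphism free_morphism.
Proof. by apply: basis_morphismP => // s t i; apply: tree_eval_graft. Qed.

Lemma free_morphism_generator a : free_morphism 2%N (generator K a) = g a.
Proof.
apply: tot_inj; rewrite [free_morphism _ _]basis_morphismE tot_basis_image /=.
by rewrite /tnode !tcomp_unitr.
Qed.

(** Every syntax tree is a composition of corollas, so a morphism is forced by its values on the
    generators. *)
Lemma tmap_tree_eval (f : forall n, {linear free_operad K G n -> Q n}) :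
  operad_morphism f -> (forall a, f 2%N (generator K a) = g a) ->
  forall t : syntax_set_operad G, tmap f (tbasis K t) = tree_eval t.
Proof.
move=> fM fg; elim=> [|a l IHl r IHr]; first by rewrite tbasis_unit tmap_unit.
have corolla : tbasis K (BNode a BLeaf BLeaf : syntax_set_operad G)
    = tot (generator K a) by rewrite /generator tot_basis.
(* The subtrees are grafted in the order used by [tnode]. *)
have node : (BNode a l r : syntax_set_operad G)
    = so_comp (so_comp (BNode a BLeaf BLeaf : syntax_set_operad G) 1 r) 0 l by [].
rewrite {1}node !tbasis_comp // corolla !tmap_comp //.
by rewrite [tmap f (tot _)]/tmap /= fg IHl IHr.
Qed.

Lemma free_morphism_eq (f : forall n, {linear free_operad K G n -> Q n}) :
  operad_morphism f -> (forall a, f 2%N (generator K a) = g a) ->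
  forall n, f n =1 free_morphism n.
Proof.
move=> fM fg n; apply: lin_operad_eq => [||t]; try exact: linearP.
rewrite [RHS]basis_morphismE; apply: tot_inj.
by rewrite tot_basis_image -(tmap_tree_eval fM fg) -tot_basis.
Qed.

End FreeUniversal.

Lemma free_operad_ext (K : fieldType) (G : choiceType) (Q : operad K)
    (f h : forall n, {linear free_operad K G n -> Q n}) :
  operad_morphism f -> operad_morphism h ->
  (forall a, f 2%N (generator K a) = h 2%N (generator K a)) ->
  forall n, f n =1 h n.
Proof.
move=> fM hM fh n x; rewrite (free_morphism_eq fM fh).
by rewrite (free_morphism_eq hM (fun=> erefl)).
Qed.

(** * Evaluation of Schroeder trees at associative products *)

Section SchroederUniversal.
Variables (K : fieldType) (gamma : nat) (Q : operad K) (g : 'I_gamma -> Q 2%N).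
Local Notation tree := (labelled_tree 'I_gamma).
Local Notation alt_trees := (alt_schroeder_set_operad gamma).
Implicit Types (s t u : tree) (ss ts : seq tree).

Fixpoint schroeder_eval t : total Q :=
  match t with
  | SLeaf => tot (op_unit Q)
  | SNode a ts => comb (tot (g a)) (map schroeder_eval ts)
  end.

Lemma tag_schroeder_eval t : is_schroeder t -> tag (schroeder_eval t) = leaves t.
Proof.
elim/labelled_tree_nested_ind: t => //= a ts IHts /andP[sz sts].
rewrite tag_comb // ?size_map; last by lia.
rewrite -map_comp; congr sumn; elim: ts IHts sts {sz} => //= t ts IH [IHt IHts].
by case/andP=> /IHt -> /(IH IHts) ->.
Qed.

Lemma tag_comb_eval a ts : (0 < size ts)%N -> all (@is_schroeder _) ts ->
  tag (comb (tot (g a)) (map schroeder_eval ts)) = sumn (map (@leaves _) ts).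
Proof.
move=> sz sts; rewrite tag_comb ?size_map // -map_comp; congr sumn.
by apply/eq_in_map => t /(allP sts)/tag_schroeder_eval.
Qed.

Lemma size_graft_forest a ss i t : is_schroeder t -> (0 < size ss)%N ->
  (0 < size (graft_forest a ss i t))%N.
Proof.
move=> st; case: ss => //= u us _; case: ifP => // _; rewrite size_cat.
by case: ifP => // _; rewrite ltn_addr ?size_splice.
Qed.

(** If [t] is rooted at [a], its value is already the [a]-product of its children; otherwise the
    product has the single factor [t]. *)
Lemma schroeder_eval_splice a t : is_schroeder t ->
  comb (tot (g a)) (map schroeder_eval (splice a t)) = schroeder_eval t.
Proof. by rewrite /splice; case: t => //= b ts _; case: eqP => [[<-]|]. Qed.

Hypothesis assoc_g : forall a,
  op_comp (g a) ord0 (g a) = op_comp (g a) ord_max (g a).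

(** Grafting replaces the child holding the leaf by a block of children. The product of that block
    is the composite wanted for this child, and associativity inserts the block among the
    siblings. *)
Lemma schroeder_eval_graft s t i : is_schroeder s -> is_schroeder t ->
  (i < leaves s)%N ->
  schroeder_eval (graft_contract s i t)
    = tcomp (schroeder_eval s) i (schroeder_eval t).
Proof.
move=> + st; elim/labelled_tree_nested_ind: s i => [|a ss IHss] i.
  by case: i => // _ _; rewrite tcomp_unitl.
rewrite graft_contract_node /=.
have assoc_ga : tcomp (tot (g a)) 0 (tot (g a)) = tcomp (tot (g a)) 1 (tot (g a)).
  transitivity (tot (op_comp (g a) ord0 (g a))); first by rewrite -tcompE.
  by rewrite assoc_g -tcompE.
(* The induction along the children keeps only nonemptiness, because a tail of the list may have a
   single element. *)
case/andP=> sz sss lti; have {sz} : (0 < size ss)%N by lia.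
elim: ss IHss i sss lti => //= u us IH [IHu IHus] i /andP[su sus] lti _.
have tagu := tag_schroeder_eval su.
case: ltnP => [iu|ui].
  (* [us1] is the block replacing [u]: several trees when a contraction takes place at this leaf,
     and one tree otherwise. *)
  set us1 := if is_leaf u then _ else _.
  have us1_gt0 : (0 < size us1)%N by rewrite /us1; case: ifP => // _; apply: size_splice.
  have us1E : comb (tot (g a)) (map schroeder_eval us1)
      = tcomp (schroeder_eval u) i (schroeder_eval t).
    rewrite /us1; case: u IHu su iu {lti tagu us1 us1_gt0} => [|b vs] IHu su iu.
      by rewrite schroeder_eval_splice //; case: i iu => // _; rewrite tcomp_unitl.
    by rewrite -IHu.
  rewrite map_cat; case: us {IH IHus sus lti} => [|v vs]; first by rewrite cats0 us1E.
  rewrite comb_cat ?size_map // us1E [RHS]/= tcomp_tnodel ?tagu //.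
(* A leaf lying beyond those of [u] belongs to a later sibling, so the product has a second
   factor. *)
have us_gt0 : (0 < size us)%N by case: us {IH IHus sus} lti => //=; lia.
rewrite [map _ (u :: _)]/= comb_cons ?size_map; last exact: size_graft_forest.
rewrite -/(comb _ (schroeder_eval u :: map schroeder_eval us)) comb_cons ?size_map //.
rewrite tcomp_tnoder ?tagu ?tag_comb_eval //.
by rewrite -IH //; lia.
Qed.

Definition alt_schroeder_eval (t : alt_trees) : total Q := schroeder_eval (val t).

Lemma tag_alt_schroeder_eval (t : alt_trees) : tag (alt_schroeder_eval t) = so_arity t.
Proof. by apply: tag_schroeder_eval; case/andP: (valP t). Qed.

Definition alt_schroeder_morphism :
    forall n, {linear alt_schroeder_operad K gamma n -> Q n} :=
  basis_morphism tag_alt_schroeder_eval.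

Lemma alt_schroeder_morphismP : operad_morphism alt_schroeder_morphism.
Proof.
apply: basis_morphismP => // s t i lti.
by apply: schroeder_eval_graft => //; [case/andP: (valP s) | case/andP: (valP t)].
Qed.

End SchroederUniversal.

(** * Alternating Schroeder trees are generated by corollas *)

Section SchroederGenerators.
Variables (K : fieldType) (gamma : nat).
Local Notation tree := (labelled_tree 'I_gamma).
Local Notation alt_trees := (alt_schroeder_set_operad gamma).
Local Notation A := (alt_schroeder_operad K gamma).
Implicit Types (t : tree) (ts : seq tree).

Definition alt_corolla_tree (a : 'I_gamma) : alt_trees :=
  Sub (SNode a [:: SLeaf; SLeaf]) isT.

Definition alt_corolla (a : 'I_gamma) : A 2%N :=
  lin_basis K (Sub (alt_corolla_tree a) isT : so_at alt_trees 2).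

Lemma alt_corollaA a :
  op_comp (alt_corolla a) ord0 (alt_corolla a)
    = op_comp (alt_corolla a) ord_max (alt_corolla a).
Proof.
rewrite /alt_corolla !op_comp_basis; congr lin_basis; apply/val_inj/val_inj.
by rewrite /= /splice /= eqxx.
Qed.

Lemma tot_alt_corolla a : tot (alt_corolla a) = tbasis K (alt_corolla_tree a).
Proof. by rewrite /alt_corolla tot_basis. Qed.

(** [splice] treats two cases at once: for one factor [r] is that factor, and for more it is the
    node labelled [a] over them. No factor is absorbed, since none is rooted at [a]. *)
Lemma alt_corolla_eval_forest (a : 'I_gamma) (ts : seq (alt_schroeder_tree gamma)) :
  (0 < size ts)%N -> all (fun t : alt_schroeder_tree gamma => root_label (val t) != Some a) ts ->
  exists2 r : alt_trees,
    comb (tot (alt_corolla a)) (map (@tbasis K alt_trees) ts) = tbasis K r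
    & splice a (val r) = map val ts.
Proof.
elim: ts => //= u us IH _ /andP[ua usa].
case: us IH usa => [|v vs] IH usa.
  by exists u => //; rewrite /splice (negbTE ua).
have [r -> ra] := IH isT usa.
pose c := alt_corolla_tree a.
(* Grafting [r] on the right leaf of the corolla contracts exactly when [r] is rooted at [a];
   grafting [u] on the left leaf never does. *)
exists (so_comp (so_comp (c : alt_trees) 1 r) 0 u : alt_trees).
  by rewrite /tnode tot_alt_corolla !tbasis_comp.
by rewrite /= -[in RHS]/(map val (v :: vs)) -ra /splice /= eqxx /= (negbTE ua) cats0.
Qed.

(** Alternation ensures that multiplying the children of a node by corollas with its label rebuilds
    this node and contracts no edge to its children. *)
Lemma alt_corolla_eval (t : alt_trees) :
  alt_schroeder_eval alt_corolla t = tbasis K t.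
Proof.
case: t => t; rewrite /alt_schroeder_eval /=.
elim/labelled_tree_nested_ind: t => [|a ts IHts] tP.
  by rewrite -/alt_leaf /= -tbasis_unit; congr tbasis; apply: val_inj.
have /andP[/= /andP[sz sts] ats] := tP.
have [us usE usB] : exists2 us : seq (alt_schroeder_tree gamma), map val us = ts
    & map (schroeder_eval alt_corolla) ts = map (@tbasis K alt_trees) us.
  elim: ts IHts sts ats {sz tP} => [|t ts IH] /=; first by exists [::].
  move=> [IHt IHts] /andP[st sts] /andP[/andP[_ alt_t] ats].
  have [us <- ->] := IH IHts sts ats.
  have tP : is_schroeder t && is_alternating t by rewrite st.
  by exists (Sub t tP :: us) => //=; rewrite (IHt tP).
rewrite /= usB; have [||r -> ra] := @alt_corolla_eval_forest a us.
- by rewrite -(size_map val) usE; apply: ltnW.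
- by rewrite -(all_map val (fun t : tree => root_label t != Some a)) usE;
    apply: sub_all ats => t /andP[].
congr tbasis; apply: val_inj; move: ra; rewrite usE /splice /=.
(* At least two children cannot form the singleton obtained by splicing a tree not rooted at [a], so
   [r] is the node itself. *)
case: (sval r) => [|b rs] /=; first by move=> tsE; move: sz; rewrite -tsE.
by case: eqP => [[->] ->|_ tsE] //; move: sz; rewrite -tsE.
Qed.

(** A morphism commutes with evaluation, so the composite evaluates a tree at the corollas, which
    returns the tree. *)
Lemma alt_schroeder_morphism_id (Q : operad K) (g : 'I_gamma -> Q 2%N)
    (f : forall n, {linear Q n -> A n}) : operad_morphism f ->
  (forall a, f 2%N (g a) = alt_corolla a) ->
  forall n (x : A n), f n (alt_schroeder_morphism g n x) = x.
Proof.
move=> fM fg n.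
apply: lin_operad_eq => [||t]; first exact: linear_comp (linearP _) (linearP _).
  exact: linear_id.
rewrite [alt_schroeder_morphism _ _ _]basis_morphismE; apply: tot_inj.
rewrite -[LHS]/(tmap f (tot _)) tot_basis_image tot_basis -alt_corolla_eval.
rewrite /alt_schroeder_eval; elim/labelled_tree_nested_ind: (val (val t)) => [|a ts IHts].
  exact: tmap_unit.
rewrite /= -fg; elim: ts IHts => [|u us IH] /=; first by rewrite tmap_unit.
case: us IH => [|v vs] IH [IHu IHus]; first exact: IHu.
rewrite [in LHS]/tnode [in RHS]/tnode !tmap_comp //.
by rewrite IHu IH.
Qed.

End SchroederGenerators.

(** * The associator as a bilinear map *)

Section Associator.
Variables (K : fieldType) (O : operad K).

Definition associator (x y : O 2%N) : O 3%N :=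
  op_comp x (ord0 : 'I_2) y - op_comp x (ord_max : 'I_2) y.

Lemma associator_linearl y : linear (associator^~ y).
Proof.
move=> a x x' /=; rewrite /associator !op_comp_linearl.
by rewrite scalerBr opprD addrACA.
Qed.

Lemma associator_linearr x : linear (associator x).
Proof.
move=> a y y'; rewrite /associator !op_comp_linearr.
by rewrite scalerBr opprD addrACA.
Qed.

Lemma associator_sum (I : Type) (r : seq I) (P : pred I) (x : I -> O 2%N) :
  associator (\sum_(i <- r | P i) x i) (\sum_(i <- r | P i) x i)
    = \sum_(i <- r | P i) \sum_(j <- r | P j) associator (x i) (x j).
Proof.
rewrite (lin_fun_sum (associator_linearl _)); apply: eq_bigr => i _.
exact: (lin_fun_sum (associator_linearr _)).
Qed.

(* Grouping the pairs (i, j) by their maximum k, the k-th group is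
   associator c_{k+1} c_{k+1} - associator c_k c_k. *)
Lemma associator_telescope (c : nat -> O 2%N) (e : nat -> K) n :
  c 0%N = 0 -> (forall m, associator (c m) (c m) = 0) ->
  \sum_(i < n) \sum_(j < n)
     e (maxn i j) *: associator (c i.+1 - c i) (c j.+1 - c j) = 0.
Proof.
move=> c0 cA; elim: n => [|n IHn]; first by rewrite big_ord0.
have sum_c m : \sum_(i < m) (c i.+1 - c i) = c m.
  by elim: m => [|m IHm]; rewrite ?big_ord0 // big_ord_recr /= IHm addrC subrK.
have Al y := lin_funB (associator_linearl y).
have Ar x := lin_funB (associator_linearr x).
(* Passing from [n] to [n.+1] adds a column, a row and a corner, all of weight [e n]. The column and
   row sums telescope from [c 0 = 0], and the three added associators cancel by [cA]. *)
rewrite big_ord_recr /= [X in X + _](_ : _ = e n *: associator (c n) (c n.+1 - c n)).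
  rewrite big_ord_recr /= maxnn.
  rewrite [X in _ + (X + _)](_ : _ = e n *: associator (c n.+1 - c n) (c n)).
    by rewrite -!scalerDr !Al !Ar !cA !subr0 !sub0r addNKr subrr scaler0.
  rewrite -[X in _ = _ *: associator _ X](sum_c n) (lin_fun_sum (associator_linearr _)) scaler_sumr.
  by apply: eq_bigr => j _; rewrite (maxn_idPl (ltnW (ltn_ord j))).
under eq_bigr do rewrite big_ord_recr.
rewrite big_split /= IHn add0r -[X in _ = _ *: associator X _](sum_c n).
rewrite (lin_fun_sum (associator_linearl _)) scaler_sumr; apply: eq_bigr => i _.
by rewrite (maxn_idPr (ltnW (ltn_ord i))).
Qed.

End Associator.

Lemma associator_morphism (K : fieldType) (P Q : operad K)
    (f : forall n, {linear P n -> Q n}) (x y : P 2%N) : operad_morphism f ->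
  f 3%N (associator x y) = associator (f 2%N x) (f 2%N y).
Proof. by move=> [_ fM]; rewrite /associator linearB; congr (_ - _); exact: (fM 2%N 2%N). Qed.

(** * The bilinear form in arity 3 and expansion along it *)

Section KoszulForm.
Variables (K : fieldType) (G : choiceType).
Local Notation form := (@koszul_form K G).
Local Notation star := (generator K).

(** As an iterated linear extension, with scalars seen as the module [K^o], the form inherits
    linearity in each argument. *)
Lemma bilin_extE (T U : choiceType) (f : T -> U -> K) x y :
  bilin_ext f x y = lin_ext (V := K^o) (fun t => lin_ext (V := K^o) (f t) y) x.
Proof.
apply: eq_bigr => t _; rewrite scaler_sumr; apply: eq_bigr => u _.
by rewrite /GRing.scale /= mulrA.
Qed.

Lemma koszul_form_linearl y : linear (fun x => form x y : K^o).
Proof. by move=> a x x'; rewrite /koszul_form !bilin_extE lin_ext_linear. Qed.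

Lemma koszul_form_linearr x : linear (fun y => form x y : K^o).
Proof.
move=> a y y'; rewrite /koszul_form !bilin_extE -lin_ext_linearf.
by apply: eq_lin_ext => t; rewrite lin_ext_linear.
Qed.

(** Three leaves split at the root as 1 + 2 or 2 + 1, which gives the two kinds of compositions. *)
Lemma free_basis3 (t : so_at (syntax_set_operad G) 3) :
  exists g h (i : 'I_2), lin_basis K t = op_comp (star g) i (star h).
Proof.
have lr0 (u : syntax_tree G) : syntax_leaves u = 1%N -> u = BLeaf.
  case: u => //= a l r lr.
  by have := syntax_leaves_gt0 l; have := syntax_leaves_gt0 r; lia.
have lr1 (u : syntax_tree G) : syntax_leaves u = 2%N -> exists h, u = BNode h BLeaf BLeaf.
  case: u => //= h l r lr; have l0 := syntax_leaves_gt0 l; have r0 := syntax_leaves_gt0 r.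
  have l1 : syntax_leaves l = 1%N by lia.
  have r1 : syntax_leaves r = 1%N by lia.
  by exists h; rewrite (lr0 l l1) (lr0 r r1).
case: t => [[//|g l r] t3].
have lr3 : (syntax_leaves l + syntax_leaves r = 3)%N by apply: eqP t3.
have := syntax_leaves_gt0 l; have := syntax_leaves_gt0 r => r0 l0.
have [l1|l2] : syntax_leaves l = 1%N \/ syntax_leaves l = 2%N by lia.
  have [|h rE] := lr1 r; first by lia.
  exists g, h, ord_max; rewrite /generator op_comp_basis; congr lin_basis.
  by apply: val_inj; rewrite /= (lr0 l l1) rE.
have [h lE] := lr1 l l2; have r1 : syntax_leaves r = 1%N by lia.
exists g, h, ord0; rewrite /generator op_comp_basis.
by congr lin_basis; apply: val_inj; rewrite /= (lr0 r r1) lE.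
Qed.

End KoszulForm.

Section Expansion.
Variables (K : fieldType) (G : finType).
Local Notation star := (generator K).

(** This is the case of a basis element in [koszul_expansion], with the values of the form written
    out. *)
Lemma sum_signed_delta (V : lmodType K) (X : 'I_2 -> G -> G -> V) g h i :
  \sum_(g' : G) \sum_(h' : G)
    ((if [&& g' == g, h' == h & ord0 == i] then (-1) ^+ (ord0 : 'I_2) else 0) *: X ord0 g' h'
     - (if [&& g' == g, h' == h & ord_max == i] then (-1) ^+ (ord_max : 'I_2) else 0)
       *: X ord_max g' h')
  = X i g h.
Proof.
rewrite (bigD1 g) //= (bigD1 h) //= !eqxx /= !big1 ?addr0 => [|g' g'g|h' h'h].
- case: i => -[|[|//]] lti.
    rewrite (_ : Ordinal lti = ord0); last exact: val_inj.
    by rewrite expr0 scale1r scale0r subr0.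
  rewrite (_ : Ordinal lti = ord_max); last exact: val_inj.
  by rewrite expr1 scaleN1r opprK scale0r add0r.
- by apply: big1 => h' _; rewrite (negbTE g'g) !scale0r subr0.
- by rewrite (negbTE h'h) !scale0r subr0.
Qed.

(** The compositions of two generators form an orthogonal basis whose elements have square 1 or -1,
    so pairing with them recovers the coordinates of [y]. The minus sign compensates the square
    -1. *)
Lemma koszul_expansion (V : lmodType K) (L : free_operad K G 3%N -> V)
    (y : free_operad K G 3%N) : linear L ->
  L y = \sum_(g : G) \sum_(h : G)
    (koszul_form (op_comp (star g) (ord0 : 'I_2) (star h)) y
        *: L (op_comp (star g) (ord0 : 'I_2) (star h))
     - koszul_form (op_comp (star g) (ord_max : 'I_2) (star h)) y
        *: L (op_comp (star g) (ord_max : 'I_2) (star h))).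
Proof.
move=> lL.
(* Rewriting koszul_form in place makes unification compare elements of the
   free operad by unfolding, which diverges. *)
have comb_lin (a p p1 p2 q q1 q2 : K) (u v : V) : p = a * p1 + p2 ->
    q = a * q1 + q2 ->
    p *: u - q *: v = a *: (p1 *: u - q1 *: v) + (p2 *: u - q2 *: v).
  by move=> -> ->; rewrite !scalerDl -!scalerA scalerBr opprD addrACA.
have comb_eq (p p' q q' : K) (u v w : V) : p = p' -> q = q' ->
    p' *: u - q' *: v = w -> p *: u - q *: v = w by move=> -> ->.
move: y; apply: lin_operad_eq => // [a y y'|t].
  have formD x : koszul_form x (a *: y + y') = a * koszul_form x y + koszul_form x y'.
    exact: koszul_form_linearr.
  rewrite scaler_sumr -big_split /=; apply: eq_bigr => g _.
  rewrite scaler_sumr -big_split /=; apply: eq_bigr => h _.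
  apply: comb_lin; exact: formD.
have [g [h [i ->]]] := free_basis3 K t.
pose X i g h : V := L (op_comp (star g) (i : 'I_2) (star h)).
rewrite -[LHS]/(X i g h) -sum_signed_delta.
apply: eq_bigr => g' _; apply: eq_bigr => h' _; symmetry.
by apply: comb_eq; [exact: koszul_form_generators.. |].
Qed.

End Expansion.

(** * The annihilator of the relations of As *)

Section DAsRelations.
Variables (K : fieldType) (gamma : nat).
Local Notation F := (free_operad K 'I_gamma).
Local Notation star := (generator K).

Definition star_sum (m : nat) : F 2%N := \sum_(a < gamma | (a < m)%N) star a.

(** The form and the associator both change sign from the first composition to the second, so the
    value does not depend on [i]. *)
Lemma koszul_form_associator (a b a' b' : 'I_gamma) (i : 'I_2) :
  koszul_form (op_comp (star a) i (star b)) (associator (star a') (star b'))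
    = ((a == a') && (b == b'))%:R.
Proof.
have sub_eq (p p' q q' r : K) : p = p' -> q = q' -> p' - q' = r -> p - q = r.
  by move=> -> ->.
rewrite /associator (lin_funB (@koszul_form_linearr _ _ _)).
apply: sub_eq; [exact: koszul_form_generators.. |].
case: (a == a') (b == b') => [] [] //=; rewrite ?subrr //.
case: i => -[|[|//]] lti; rewrite -!val_eqE /= ?expr0 ?expr1 ?subr0 ?sub0r //.
by rewrite opprK.
Qed.

Lemma koszul_form_star_sum a b (i : 'I_2) m :
  koszul_form (op_comp (star a) i (star b)) (associator (star_sum m) (star_sum m))
    = ((a < m) && (b < m))%N%:R.
Proof.
rewrite associator_sum (lin_fun_sum (@koszul_form_linearr _ _ _)).
transitivity (\sum_(a' < gamma | (a' < m)%N) \sum_(b' < gamma | (b' < m)%N)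
    ((a == a')%:R * (b == b')%:R : K)).
  apply: eq_bigr => a' _; rewrite (lin_fun_sum (@koszul_form_linearr _ _ _)).
  by apply: eq_bigr => b' _; rewrite -natrM mulnb; apply: koszul_form_associator.
have delta (c : 'I_gamma) : \sum_(c' < gamma | (c' < m)%N) ((c == c')%:R : K) = (c < m)%N%:R.
  rewrite big_mkcond (bigD1 c) //= eqxx big1 ?addr0 => [|c' /negbTE c'c]; first by case: ifP.
  by rewrite eq_sym c'c; case: ifP.
under eq_bigr do rewrite -big_distrr /= delta.
by rewrite -big_distrl /= delta -natrM mulnb.
Qed.

Lemma val_ord_maxn (a b : 'I_gamma) : ord_maxn a b = maxn a b :> nat.
Proof. by rewrite /ord_maxn /maxn; case: ifP. Qed.

(** By [koszul_form_star_sum], the pairing ignores the position and depends only on whether max(a,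
    b) < m. The two terms of each generating relation share this maximum. *)
Lemma star_sum_relation m :
  annihilator (@As_relations K gamma) (associator (star_sum m) (star_sum m)).
Proof.
move=> x [n [c [v [Rv ->]]]].
rewrite (lin_fun_sum (@koszul_form_linearl _ _ _)); apply: big1 => k _.
have sub_eq0 (p q r : K) : p = r -> q = r -> p - q = 0 by move=> -> ->; apply: subrr.
have formZ := lin_funZ (koszul_form_linearl (associator (star_sum m) (star_sum m))).
apply: (etrans (formZ _ _)).
suff -> : koszul_form (v k) (associator (star_sum m) (star_sum m)) = 0 by apply: scaler0.
have formB := lin_funB (koszul_form_linearl (associator (star_sum m) (star_sum m))).
case: (Rv k) => a b; apply: etrans (formB _ _) _;
  apply: (sub_eq0 _ _ _ (koszul_form_star_sum _ _ _ _));
  by apply: etrans (koszul_form_star_sum _ _ _ _) _; rewrite val_ord_maxn gtn_max andbb.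
Qed.

(** Together with the sign of the form, this says that an element of the annihilator is a
    combination of associators with coefficients depending only on the maximum. *)
Lemma As_annihilatorP y a b (i : 'I_2) :
  annihilator (@As_relations K gamma) y ->
  koszul_form (op_comp (star a) i (star b)) y
    = koszul_form (op_comp (star (ord_maxn a b)) (ord_max : 'I_2)
                     (star (ord_maxn a b))) y.
Proof.
move=> yA; have relA r : As_generating_relation r -> koszul_form r y = 0.
  move=> Rr; apply: yA; exists 1%N, (fun=> 1), (fun=> r).
  by rewrite big_ord1 scale1r.
apply/eqP; rewrite -subr_eq0 -[X in X == _](lin_funB (koszul_form_linearl y)).
case: i => -[|[|//]] lti; apply/eqP/relA.
  by rewrite (_ : Ordinal lti = ord0); [exact: As_relation1 | apply: val_inj].
by rewrite (_ : Ordinal lti = ord_max); [exact: As_relation2 | apply: val_inj].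
Qed.

End DAsRelations.

(** * The two mutually inverse morphisms *)

Section Isomorphism.
Variables (K : fieldType) (gamma : nat).
Local Notation F := (free_operad K 'I_gamma).
Local Notation A := (alt_schroeder_operad K gamma).
Local Notation D := (DAs_operad K gamma).
Local Notation star := (generator K).

Local Notation pi := (quot_pi_of (gen_ideal (annihilator (@As_relations K gamma)))).

(* Partial sums turn the condition max(a, b) = m into a, b <= m, so these
   generators are associative in DAs. *)
Definition diamond (a : 'I_gamma) : D 2%N := pi 2%N (star_sum K gamma a.+1).

Lemma diamondA a :
  op_comp (diamond a) ord0 (diamond a) = op_comp (diamond a) ord_max (diamond a).
Proof.
apply/eqP; rewrite -subr_eq0 -[X in X == _]/(associator (diamond a) (diamond a)).
rewrite -(associator_morphism _ _ (quot_pi_morphism _)); apply/eqP.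
rewrite -(linear0 (pi 3%N)); apply/quot_piP; rewrite subr0.
by apply/asboolP => I; apply; apply: star_sum_relation.
Qed.

Definition alt_to_DAs : forall n, {linear A n -> D n} := alt_schroeder_morphism diamond.

Lemma alt_to_DAsP : operad_morphism alt_to_DAs.
Proof. by apply: alt_schroeder_morphismP; apply: diamondA. Qed.

(** The shift by one makes room for [corolla 0 = 0], where telescoping starts. The default 0 beyond
    [gamma] keeps all associators zero. *)
Definition corolla (m : nat) : A 2%N :=
  if m is k.+1 then oapp (@alt_corolla K gamma) 0 (insub k) else 0.

Lemma corollaS (a : 'I_gamma) : corolla a.+1 = alt_corolla K a.
Proof. by rewrite /= valK. Qed.

Lemma corollaA m : associator (corolla m) (corolla m) = 0.
Proof.
have A0 := lin_fun0 (associator_linearl (0 : A 2%N)).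
have Aa a : associator (alt_corolla K a) (alt_corolla K a) = 0.
  by rewrite /associator alt_corollaA subrr.
case: m => [|k]; first exact: A0.
by rewrite /corolla; case: insub => [a|]; [apply: Aa | apply: A0].
Qed.

Definition free_to_alt : forall n, {linear F n -> A n} :=
  free_morphism (fun a : 'I_gamma => corolla a.+1 - corolla a).

Lemma free_to_altP : operad_morphism free_to_alt.
Proof. exact: free_morphismP. Qed.

Lemma free_to_alt_star (a : 'I_gamma) :
  free_to_alt 2%N (star a) = corolla a.+1 - corolla a.
Proof. exact: free_morphism_generator. Qed.

(** Expanding [y] turns its image into the weighted sum of associators that [associator_telescope]
    cancels. *)
Lemma free_to_alt_annihilator y :
  annihilator (@As_relations K gamma) y -> free_to_alt 3%N y = 0.
Proof.
move=> yA; rewrite (koszul_expansion y (linearP (free_to_alt 3%N))).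
(* [e m] is the common pairing of [y] at maximum [m], extended by 0 to all natural numbers. *)
pose e m : K := oapp (fun c => koszul_form
  (op_comp (star c) (ord_max : 'I_2) (star c)) y) 0 (insub m : option 'I_gamma).
rewrite -[RHS](@associator_telescope K A corolla e gamma erefl corollaA).
apply: eq_bigr => a _; apply: eq_bigr => b _.
have formE (i : 'I_2) : koszul_form (op_comp (star a) i (star b)) y = e (maxn a b).
  by apply: etrans (As_annihilatorP _ _ _ yA) _; rewrite /e -val_ord_maxn valK.
have compE (i : 'I_2) : free_to_alt 3%N (op_comp (star a) i (star b))
    = op_comp (corolla a.+1 - corolla a) i (corolla b.+1 - corolla b).
  by rewrite -!free_to_alt_star; exact: (free_to_altP.2 2%N 2%N).
have scale_eq (V : lmodType K) (p q k : K) (u u' v v' : V) :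
    p = k -> q = k -> u = u' -> v = v' -> p *: u - q *: v = k *: (u' - v').
  by move=> -> -> -> ->; rewrite scalerBr.
exact: scale_eq (formE _) (formE _) (compE _) (compE _).
Qed.

Definition DAs_to_alt : forall n, {linear D n -> A n} :=
  quot_morphism free_to_altP free_to_alt_annihilator.

Lemma DAs_to_altP : operad_morphism DAs_to_alt.
Proof. exact: quot_morphismP. Qed.

Lemma free_to_alt_star_sum m : (m <= gamma)%N ->
  free_to_alt 2%N (star_sum K gamma m) = corolla m.
Proof.
move=> lem; rewrite linear_sum; under eq_bigr do rewrite free_to_alt_star.
rewrite -(big_ord_widen _ (fun a => corolla a.+1 - corolla a) lem).
elim: m {lem} => [|m IHm]; first by rewrite big_ord0.
by rewrite big_ord_recr IHm -[LHS]/(corolla m + (corolla m.+1 - corolla m)) addrC subrK.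
Qed.

Lemma DAs_to_alt_diamond a : DAs_to_alt 2%N (diamond a) = alt_corolla K a.
Proof. by rewrite [LHS]quot_morphism_pi free_to_alt_star_sum // corollaS. Qed.

Lemma alt_to_DAsK n : cancel (alt_to_DAs n) (DAs_to_alt n).
Proof. exact: (alt_schroeder_morphism_id DAs_to_altP DAs_to_alt_diamond). Qed.

Lemma alt_to_DAs_corolla m : (m <= gamma)%N ->
  alt_to_DAs 2%N (corolla m) = pi 2%N (star_sum K gamma m).
Proof.
case: m => [_|k ltk]; first by rewrite linear0 /star_sum big_pred0_eq linear0.
rewrite -[k.+1]/((Ordinal ltk).+1) corollaS [LHS]basis_morphismE.
apply: tot_inj; rewrite tot_basis_image /alt_schroeder_eval /= /tnode.
by rewrite !tcomp_unitr.
Qed.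

Lemma star_sumS (a : 'I_gamma) : star_sum K gamma a.+1 - star_sum K gamma a = star a.
Proof.
suff -> : star_sum K gamma a.+1 = star a + star_sum K gamma a by apply: addrK.
rewrite /star_sum (bigD1 a) //; congr (_ + _); apply: eq_bigl => b.
by rewrite ltnS (leq_eqVlt b) val_eqE; case: eqVneq => [->|]; rewrite ?ltnn ?andbT.
Qed.

(** After composition with the projection, both sides are morphisms from the free operad, so they
    are compared on generators, each a difference of consecutive partial sums. *)
Lemma DAs_to_altK n : cancel (DAs_to_alt n) (alt_to_DAs n).
Proof.
move=> x; have [v ->] := quot_pi_surj x; rewrite [DAs_to_alt n _]quot_morphism_pi.
move: v; apply: (free_operad_ext
  (operad_morphism_comp free_to_altP alt_to_DAsP) (quot_pi_morphism _)) => a.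
rewrite -[LHS]/(alt_to_DAs 2%N (free_to_alt 2%N (star a))) free_to_alt_star.
rewrite linearB !alt_to_DAs_corolla ?(ltnW (ltn_ord a)) //.
by rewrite -linearB star_sumS.
Qed.

End Isomorphism.

Theorem proposition5p1p5 (K : fieldType) (charK : [pchar K] =i pred0)
    (gamma : nat) :
  exists phi : forall n,
      {linear alt_schroeder_operad K gamma n -> DAs_operad K gamma n},
    operad_isomorphism phi /\
    (forall n m (s : so_at (alt_schroeder_set_operad gamma) n) (i : 'I_n)
        (t : so_at (alt_schroeder_set_operad gamma) m),
      exists2 r : so_at (alt_schroeder_set_operad gamma) (n + m).-1,
        alt_tree r = graft_contract (alt_tree s) i (alt_tree t) &
        op_comp (phi n (lin_basis K s)) i (phi m (lin_basis K t))
          = phi (n + m).-1 (lin_basis K r)).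
Proof.
have [phi1 phiM] := alt_to_DAsP K gamma.
exists (@alt_to_DAs K gamma); split=> [|n m s i t].
  by split=> // n; exists (DAs_to_alt K gamma n); [exact: alt_to_DAsK | exact: DAs_to_altK].
(* The underlying tree of this composition is the contracted graft by definition. *)
exists (so_comp_at s i t) => //.
by rewrite -phiM op_comp_basis.
Qed.
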